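(* Let $N=(V,E,c)$ be a locally finite, connected network with $\inf_{v\in V}c(v)>0$, and let $X=(X_n)_{n\geq0}$ be a random walk on $N$. If there exists $r>3/2$ such that \[ \liminf_{n\to\infty}\frac{d(X_0,X_n)}{n^{1/2}(\log n)^r}>0 \quad\text{almost surely}, \] then $X$ has infinitely many cut times almost surely.
   Context: A network $N=(V,E,c)$ consists of a graph $(V,E)$ with conductances $c:E\to(0,\infty)$. For $u\in V$, $c(u)$ is the total conductance of all oriented edges emanating from $u$, and $c(u,v)$ is the total conductance of oriented edges from $u$ to $v$; the random walk on $N$ is the Markov chain with transition probabilities $P(u,v)=c(u,v)/c(u)$. $d$ denotes the graph distance in $(V,E)$. A cut time of a sequence $(x_n)_{n\geq 0}$ is an integer $n\geq 0$ such that $\{x_i:i\leq n\}$ and $\{x_i:i>n\}$ are disjoint. *)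

(* Defs.v *)
From HB Require Import structures.
From mathcomp Require Import all_boot all_order all_algebra.
From mathcomp Require Import all_classical all_reals all_analysis.
Set Implicit Arguments. Unset Strict Implicit. Unset Printing Implicit Defensive.
Import Order.TTheory GRing.Theory Num.Theory.
Local Open Scope classical_set_scope.
Local Open Scope ring_scope.

(* A network N = (V, E, c): a (multi)graph given by its set E of ORIENTED
   edges, with source/target maps and an orientation-reversing involution
   (each undirected edge contributes its two orientations), and
   conductances c : E -> (0, oo) invariant under reversal. *)
Record network (R : realType) := Network {
  nV : Type;
  nE : choiceType;
  src : nE -> nV;
  tgt : nE -> nV;
  erev : nE -> nE;
  cond : nE -> R;
  erevK : forall e, erev (erev e) = e;
  src_erev : forall e, src (erev e) = tgt e;
  tgt_erev : forall e, tgt (erev e) = src e;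
  cond_erev : forall e, cond (erev e) = cond e;
  cond_gt0 : forall e, 0 < cond e }.

Section Network.
Variables (R : realType) (N : network R).
Local Notation V := (nV N).
Local Notation E := (nE N).

Definition out_edges (u : V) : set E := [set e | src e = u].

Definition locally_finite : Prop := forall u : V, finite_set (out_edges u).

Definition cvert (u : V) : R := \sum_(e \in out_edges u) cond e.

Definition cpair (u v : V) : R :=
  \sum_(e \in out_edges u `&` [set e | tgt e = v]) cond e.

Definition trans (u v : V) : R := cpair u v / cvert u.

Definition adjacent (u v : V) : Prop := exists e : E, src e = u /\ tgt e = v.

Definition path_len (k : nat) (u v : V) : Prop :=
  exists x : nat -> V, [/\ x 0%N = u, x k = v &
     forall i, (i < k)%N -> adjacent (x i) (x i.+1)].

Definition connected_net : Prop := forall u v : V, exists k, path_len k u v.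

(* graph distance d(u,v): least length of a path from u to v
   (0 by convention if there is none; irrelevant for connected networks) *)
Definition gdist (u v : V) : nat :=
  match pselect (exists k, `[< path_len k u v >]) with
  | left H => ex_minn H
  | right _ => 0%N
  end.
End Network.
Arguments out_edges {R} N u.
Arguments cvert {R} N u.
Arguments cpair {R} N u v.
Arguments trans {R} N u v.
Arguments adjacent {R} N u v.
Arguments path_len {R} N k u v.
Arguments gdist {R} N u v.
Arguments locally_finite {R} N.
Arguments connected_net {R} N.

Definition cut_time (V : Type) (x : nat -> V) (n : nat) : Prop :=
  [set x i | i in [set i | (i <= n)%N]] `&` [set x i | i in [set i | (n < i)%N]]
  = set0.

(* X is a random walk on N (with arbitrary initial distribution) defined on
   the probability space (Omega, P): each {X_n = v} is an event, and the
   Markov property with transition kernel trans N holds. *)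
Definition is_random_walk (R : realType) (N : network R)
    (d : measure_display) (Omega : measurableType d) (P : probability Omega R)
    (X : nat -> Omega -> nV N) : Prop :=
  (forall n (v : nV N), measurable [set w | X n w = v]) /\
  forall (n : nat) (x : nat -> nV N) (y : nV N),
    P ([set w | forall i, (i <= n)%N -> X i w = x i] `&` [set w | X n.+1 w = y])
    = (P [set w | forall i, (i <= n)%N -> X i w = x i] * (trans N (x n) y)%:E)%E.

(* Main.v *)
(* Fix the starting vertex o, write D(x) = d(o, x) + 1, and kill the walk at x with
   probability 9 / (D(x)^2 + 9).  By the speed hypothesis the killing probabilities are
   summable along the path, so the walk started late is unlikely to be killed.  An
   Agmon-type energy estimate with test function D^4 u, for u the Green function of
   the killed walk, shows that u(x) <= C / D(x), because the total conductances are bounded below.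
   Hence h = u / C is superharmonic for the killed walk and h(X_n) decays at least like
   n^(-1/2).

   Whenever h(X) makes a new running minimum that is lower than the previous one, b, by a
   factor at least e^eta, start an attempt at level b: it succeeds if h(X) < b ever after,
   which makes a cut time, and fails at the first return to {h >= b}, after which a new
   attempt may start.  By optional stopping an attempt at x succeeds with probability at
   least 1 - h(x)/b, and therefore the expected drop of log(min h) during an attempt is at most
   C = O(log(1/a) + log(1/eta)) times its success probability, as long as the minimum is
   at least a.  Summing over the attempts within k steps, E[total drop] <= C P(some success) + k eta.
   With k = n^6, a = n^(-2) and eta = 1/k the drop is at least log n, so the probability of a
   new cut time is bounded below uniformly in the past; hence there are infinitely many. *)
Require Import Defs.
From HB Require Import structures.
From mathcomp Require Import all_boot all_order all_algebra.
From mathcomp Require Import all_classical all_reals all_analysis.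
From mathcomp Require Import ring lra zify.
Import Order.TTheory GRing.Theory Num.Theory.
Local Open Scope classical_set_scope.
Local Open Scope ring_scope.
Set Implicit Arguments.
Unset Strict Implicit.
Unset Printing Implicit Defensive.

(** * Logarithmic inequalities and the cost of an attempt *)

Section Logarithm.
Variable R : realType.
Implicit Types a b m x : R.

Lemma ln_le_subr1 x : 0 < x -> ln x <= x - 1.
Proof.
by move=> x0; have := @le_ln1Dx R (x - 1) ltac:(lra); rewrite addrC subrK.
Qed.

Lemma ln_ge_1subV x : 0 < x -> 1 - x^-1 <= ln x.
Proof.
move=> x0; have := @ln_le_subr1 x^-1; rewrite invr_gt0 lnV ?posrE // => /(_ x0).
lra.
Qed.

Lemma ln_eventually (K : R) : exists n0, forall n, (n0 <= n)%N -> K <= ln (n%:R : R).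
Proof.
exists (Num.truncn (expR K)).+1 => n nn.
have h1 : expR K <= n%:R.
  by apply: le_trans (ltW (truncnS_gt _)) _; rewrite ler_nat.
rewrite -(expRK K) ler_ln ?posrE ?expR_gt0 //.
exact: lt_le_trans (expR_gt0 K) h1.
Qed.

(* A primitive of [- 1 / (1 - exp (- s))] in the variable [s = ln (b / m)], normalised to
   vanish at [m = a]: it bounds the expected drop of the
   running minimum during an attempt at level [b], per unit of success probability. *)
Definition potential a b m : R := ln ((b - a) * m / (a * (b - m))).

Lemma potentialE a b m : 0 < a -> a < b -> 0 < m -> m < b ->
  potential a b m = ln (b - a) - ln a + (ln m - ln (b - m)).
Proof.
move=> a0 ab m0 mb; rewrite /potential.
rewrite ln_div ?posrE ?mulr_gt0 ?subr_gt0 // !lnM ?posrE ?subr_gt0 //; ring.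
Qed.

Lemma potential_ge0 a b m : 0 < a -> a <= m -> m < b -> 0 <= potential a b m.
Proof.
move=> a0 am mb; apply: ln_ge0.
rewrite ler_pdivlMr ?mul1r ?mulr_gt0 ?subr_gt0 //; nra.
Qed.

Lemma potential_mono a b m' m : 0 < a -> a <= m' -> m' <= m -> m < b ->
  potential a b m' <= potential a b m.
Proof.
move=> a0 am' m'm mb; rewrite !potentialE //; try lra.
have : ln m' <= ln m by rewrite ler_ln ?posrE //; lra.
have : ln (b - m) <= ln (b - m') by rewrite ler_ln ?posrE //; lra.
lra.
Qed.

(** With [u = ln (m / m')] and [v] the increase of [ln (b - m)], the potential drops by [u + v]. The
    tangent bounds on [ln] give [u * m' <= m - m' <= v * (b - m')], which is what remains after
    multiplying by [1 - m' / b]. A further drop during an attempt is thus paid by the loss of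
    potential. *)
Lemma potential_step a b m' m : 0 < a -> a <= m' -> m' <= m -> m < b ->
  ln (m / m') <= (potential a b m - potential a b m') * (1 - m' / b).
Proof.
move=> a0 am' m'm mb; rewrite !potentialE //; try lra.
have m0 : 0 < m by lra.
have m'0 : 0 < m' by lra.
have b0 : 0 < b by lra.
set u := ln (m / m'); set v := ln ((b - m') / (b - m)).
have uE : u = ln m - ln m' by rewrite /u ln_div ?posrE.
have vE : v = ln (b - m') - ln (b - m) by rewrite /v ln_div ?posrE //; lra.
have hu : u * m' <= m - m'.
  have := @ln_le_subr1 (m / m') ltac:(by rewrite divr_gt0).
  rewrite -/u => /(ler_wpM2r (ltW m'0)); rewrite mulrBl divfK ?mul1r //; lra.
have hv : m - m' <= v * (b - m').
  have b1 : 0 < b - m by lra.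
  have b2 : 0 < b - m' by lra.
  have := @ln_ge_1subV ((b - m') / (b - m)) ltac:(by rewrite divr_gt0).
  rewrite -/v invf_div => /(ler_wpM2r (ltW b2)).
  rewrite mulrBl divfK ?mul1r; lra.
have -> : ln (b - a) - ln a + (ln m - ln (b - m)) -
   (ln (b - a) - ln a + (ln m' - ln (b - m'))) = u + v by lra.
have -> : (u + v) * (1 - m' / b) = u + (v * (b - m') - u * m') / b.
  by field; lra.
by rewrite lerDl divr_ge0 //; lra.
Qed.

(** The part [ln a^-1 + ln eta^-1] bounds the potential when an attempt starts; the remaining
    [1 + ln a^-1] is set aside for the drop from [b] that triggers it. *)
Definition attempt_cost a eta : R := 1 + 2 * ln a^-1 + ln eta^-1.

(** [m / (b - m)] is the inverse of [b / m - 1], which is at least [ln (b / m) >= eta]; and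
    [ln (b - a) <= 0] as [b <= 1]. *)
Lemma attempt_cost_potential a eta b m : 0 < a -> 0 < eta -> a <= m -> m < b ->
  b <= 1 -> eta <= ln (b / m) ->
  potential a b m <= attempt_cost a eta - (1 + ln a^-1).
Proof.
move=> a0 eta0 am mb b1 etab; rewrite /attempt_cost potentialE //; try lra.
have m0 : 0 < m by lra.
have h1 : ln (b - a) <= 0 by apply: ln_le0; lra.
have h2 : ln m - ln (b - m) <= ln eta^-1.
  rewrite -ln_div ?posrE ?subr_gt0 // ler_ln ?posrE ?divr_gt0 ?subr_gt0 ?invr_gt0 //.
  rewrite -invf_div lef_pV2 ?posrE ?divr_gt0 ?subr_gt0 //.
  rewrite mulrBl divff ?gt_eqF //.
  by apply: (le_trans etab); apply: ln_le_subr1; rewrite divr_gt0 //; lra.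
rewrite (lnV (x := a)) ?posrE //; lra.
Qed.

(** With [q = m / b] and [l = ln (b / m)], split [l = l * q + l * (1 - q)]: the first term is at
    most [1 - q] since [l <= 1 / q - 1], the second at most [ln a^-1 * (1 - q)]. The reserve
    [1 + ln a^-1] covers both. *)
Lemma attempt_cost_start a eta b m : 0 < a -> 0 < eta -> a <= m -> m < b ->
  b <= 1 -> eta <= ln (b / m) ->
  ln (b / m) <= (attempt_cost a eta - potential a b m) * (1 - m / b).
Proof.
move=> a0 eta0 am mb b1 etab.
have h := attempt_cost_potential a0 eta0 am mb b1 etab.
have m0 : 0 < m by lra.
have b0 : 0 < b by lra.
have hD : ln (b / m) <= ln a^-1.
  rewrite ler_ln ?posrE ?divr_gt0 ?invr_gt0 //.
  rewrite ler_pdivrMr // mulrC ler_pdivlMr //; nra.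
have hm : 1 - (b / m)^-1 <= ln (b / m) by apply: ln_ge_1subV; rewrite divr_gt0.
have := @ln_le_subr1 (b / m) ltac:(by rewrite divr_gt0).
rewrite invf_div in hm.
move: hm hD h etab; set l := ln _; set q := m / b; set la := ln _.
have q1 : q < 1 by rewrite /q ltr_pdivrMr ?mul1r.
have q0 : 0 < q by rewrite divr_gt0.
have qV : b / m = q^-1 by rewrite /q invf_div.
rewrite qV => hm hD h etab hl.
have : l * q <= 1 - q.
  move: hl => /(ler_wpM2r (ltW q0)); rewrite mulrBl mulVf ?gt_eqF //; lra.
nra.
Qed.

End Logarithm.

(** * Sub-Markov operators acting on functions *)

Definition submarkov (R : realType) (S : Type) (Q : (S -> R) -> S -> R) : Prop :=
  [/\ forall (f g : S -> R) a x, Q (fun y => a * f y + g y) x = a * Q f x + Q g x,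
      forall (f g : S -> R) x, (forall y, f y <= g y) -> Q f x <= Q g x &
      forall x, Q (fun=> 1) x <= 1].

Section Submarkov.
Variables (R : realType) (S : Type) (Q : (S -> R) -> S -> R).
Hypothesis QP : submarkov Q.

Let Qlin (f g : S -> R) a x : Q (fun y => a * f y + g y) x = a * Q f x + Q g x.
Proof. by case: QP. Qed.

Lemma submarkov_le (f g : S -> R) x : (forall y, f y <= g y) -> Q f x <= Q g x.
Proof. by case: QP => _ + _; apply. Qed.

Lemma submarkov1 x : Q (fun=> 1) x <= 1.
Proof. by case: QP. Qed.

Lemma submarkov_cst0 x : Q (fun=> 0) x = 0.
Proof.
have := Qlin (fun=> 0) (fun=> 0) 1 x.
rewrite (_ : (fun y : S => _) = fun=> 0); last by apply/funext => y; lra.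
lra.
Qed.

Lemma submarkovZ (f : S -> R) a x : Q (fun y => a * f y) x = a * Q f x.
Proof.
have := Qlin f (fun=> 0) a x.
rewrite (_ : (fun y : S => _ + _) = fun y => a * f y); last first.
  by apply/funext => y; lra.
by rewrite submarkov_cst0 addr0.
Qed.

Lemma submarkovD (f g : S -> R) x : Q (fun y => f y + g y) x = Q f x + Q g x.
Proof.
have := Qlin f g 1 x; rewrite mul1r => <-; congr (Q _ x).
by apply/funext => y; rewrite mul1r.
Qed.

Lemma submarkovB (f g : S -> R) x : Q (fun y => f y - g y) x = Q f x - Q g x.
Proof.
have := Qlin g f (-1) x; rewrite mulN1r addrC => <-; congr (Q _ x).
by apply/funext => y; lra.
Qed.

Lemma submarkov_cst a x : Q (fun=> a) x = a * Q (fun=> 1) x.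
Proof.
by rewrite -submarkovZ; congr (Q _ x); apply/funext => y; rewrite mulr1.
Qed.

Lemma submarkov_ge0 (f : S -> R) x : (forall y, 0 <= f y) -> 0 <= Q f x.
Proof. by move=> f0; rewrite -(submarkov_cst0 x); apply: submarkov_le. Qed.

End Submarkov.

(** * Attempts at a cut, as recursions on the operator *)

Section Attempts.
Variables (R : realType) (S : Type) (h : S -> R) (a eta : R) (j : nat).
Hypotheses (h_ge0 : forall x, 0 <= h x).
Hypotheses (a_gt0 : 0 < a) (a_le1 : a <= 1) (eta_gt0 : 0 < eta) (eta_le1 : eta <= 1).

(* [Q] is a killed walk; being killed counts as never returning to [{h >= b}]. *)
Fixpoint noret (Q : (S -> R) -> S -> R) (b : R) (n : nat) (x : S) : R :=
  if h x < b then
    if n is n'.+1 then Q (noret Q b n') x + (1 - Q (fun=> 1) x) else 1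
  else 0.

Definition runmin (mu : R) (y : S) : R := Num.max a (Num.min mu (h y)).

(** While an attempt at [b] runs, the minimum is below [b]; a failing step therefore sets no new
    minimum and need not open another attempt. *)
Definition next_attempt (mode : option R) (mu : R) (y : S) : option R :=
  if mode is Some b then (if h y < b then Some b else None)
  else (if eta <= ln (mu / runmin mu y) then Some mu else None).

(* Probability that, after [k] steps, an attempt is under way and survives [j] more steps.
   [mode] is the level of the current attempt, if any, and [mu] the running minimum of [h],
   floored at [a]. *)
Fixpoint win (Q : (S -> R) -> S -> R) (k : nat) (mode : option R) (mu : R)
    (x : S) : R :=
  if k is k'.+1 then
    Q (fun y => win Q k' (next_attempt mode mu y) (runmin mu y) y) x
    + (1 - Q (fun=> 1) x)
  else if mode is Some b then noret Q b j x else 0.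

(* Expected decrease of [ln mu] within [k] steps. *)
Fixpoint gain (Q : (S -> R) -> S -> R) (k : nat) (mu : R) (x : S) : R :=
  if k is k'.+1 then
    Q (fun y => ln (mu / runmin mu y) + gain Q k' (runmin mu y) y) x
  else 0.

Lemma runmin_ge mu y : a <= runmin mu y.
Proof. by rewrite /runmin le_max lexx. Qed.

Lemma runmin_gt0 mu y : 0 < runmin mu y.
Proof. exact: lt_le_trans (runmin_ge mu y). Qed.

Lemma runmin_le mu y : a <= mu -> runmin mu y <= mu.
Proof. by move=> amu; rewrite ge_max amu ge_min lexx. Qed.

Lemma runmin_id mu y : a <= mu -> mu <= h y -> runmin mu y = mu.
Proof. by move=> amu muh; rewrite /runmin (min_idPl muh); exact/max_idPr. Qed.

Lemma runmin_lt mu y : a <= mu -> runmin mu y < mu -> h y <= runmin mu y.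
Proof.
move=> amu; have [muh|/ltW hmu] := lerP mu (h y); first by rewrite runmin_id ?ltxx.
by rewrite /runmin (min_idPr hmu) le_max lexx orbT.
Qed.

Lemma runmin_le_max mu y : runmin mu y <= Num.max a (h y).
Proof. by rewrite /runmin ge_max le_max lexx /= le_max !ge_min lexx !orbT. Qed.

Section OneOperator.
Variable Q : (S -> R) -> S -> R.
Hypothesis QP : submarkov Q.

Lemma noret_ge0 b n x : 0 <= noret Q b n x.
Proof.
elim: n x => [|n IH] x /=; case: ifP => // _.
by rewrite addr_ge0 // ?(submarkov_ge0 QP) // subr_ge0 (submarkov1 QP).
Qed.

(** Optional stopping, by induction on [n]: as [Q h <= h], the average of [1 - h / b] plus the
    killed mass is at least [1 - h x / b], and [1 - h / b <= 0] where the attempt fails. *)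
Lemma noret_ge b n x : (forall y, Q h y <= h y) -> 0 < b ->
  1 - h x / b <= noret Q b n x.
Proof.
move=> Qh b0; elim: n x => [|n IH] x /=; case: ifPn => hb; last 3 first.
- by rewrite -leNgt in hb; rewrite subr_le0 ler_pdivlMr ?mul1r.
- have /(submarkov_le QP x) := IH.
  rewrite (submarkovB QP) (_ : (fun y => h y / b) = fun y => b^-1 * h y).
    rewrite (submarkovZ QP).
    have : b^-1 * Q h x <= b^-1 * h x by rewrite ler_wpM2l // invr_ge0 ltW.
    by rewrite (mulrC (h x)); lra.
  by apply/funext => y; rewrite mulrC.
- by rewrite -leNgt in hb; rewrite subr_le0 ler_pdivlMr ?mul1r.
by rewrite gerBl divr_ge0 // ltW.
Qed.

Lemma win_ge0 k mode mu x : 0 <= win Q k mode mu x.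
Proof.
elim: k mode mu x => [|k IH] mode mu x /=.
  by case: mode => [b|//]; exact: noret_ge0.
by rewrite addr_ge0 // ?(submarkov_ge0 QP) // subr_ge0 (submarkov1 QP).
Qed.

Hypothesis Qh : forall x, Q h x <= h x.
Local Notation C := (attempt_cost a eta).

Lemma attempt_cost_ge1 : 1 <= C.
Proof.
rewrite /attempt_cost.
have : 0 <= ln a^-1 by apply: ln_ge0; rewrite invf_ge1.
have : 0 <= ln eta^-1 by apply: ln_ge0; rewrite invf_ge1.
lra.
Qed.

(** Joint induction on the steps left. During an attempt, [C - potential] per unit of success
    probability has been spent on earlier drops and is deducted; later drops are paid from the
    remaining potential. As [noret Q b (k + j)] is the average of its value one step later plus the
    killed mass, only the change of potential matters. *)
Lemma gain_le_win k :
  (forall mu x, a <= mu -> mu <= 1 ->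
     gain Q k mu x <= C * win Q k None mu x + k%:R * eta) /\
  (forall b mu x, a <= mu -> mu < b -> b <= 1 -> h x < b ->
     gain Q k mu x <= C * win Q k (Some b) mu x
       - (C - potential a b mu) * noret Q b (k + j) x + k%:R * eta).
Proof.
have [a0 e0 e1] : [/\ 0 < a, 0 < eta & eta <= 1] by [].
elim: k => [|k [IHf IHa]].
  split=> [mu x amu mu1|b mu x amu mub b1 hb] /=; first by rewrite mulr0 mul0r addr0.
  rewrite mul0r addr0 add0n -mulrBl opprB addrC subrK mulr_ge0 //.
    exact: potential_ge0.
  exact: noret_ge0.
have kS : k.+1%:R * eta = k%:R * eta + eta by rewrite -natr1 mulrDl mul1r.
have ke0 : 0 <= k%:R * eta by rewrite mulr_ge0 // ltW.
have cst x : Q (fun=> k%:R * eta + eta) x <= k.+1%:R * eta.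
  rewrite (submarkov_cst QP) kS ger_pMr; last by rewrite ltr_wpDl.
  exact: submarkov1.
split=> [mu x amu mu1|b mu x amu mub b1 hb] /=.
  set W := fun y : S => win Q k (next_attempt None mu y) (runmin mu y) y.
  have step y : ln (mu / runmin mu y) + gain Q k (runmin mu y) y
      <= C * W y + (k%:R * eta + eta).
    have am' := runmin_ge mu y; have m'm := runmin_le y amu.
    (* A drop of at least [eta] opens an attempt at level [mu], and [attempt_cost_start] pays for
       it; a smaller drop is charged to the [eta] of this step. *)
    rewrite /W /=; case: ifPn => [etal|].
      have m'lt : runmin mu y < mu.
        rewrite lt_neqAle m'm andbT; apply: contraTneq etal => ->.
        by rewrite divff ?ln1 -?ltNge // gt_eqF //; exact: lt_le_trans amu.
      have hm' := runmin_lt amu m'lt.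
      have mu0 : 0 < mu := lt_le_trans a_gt0 amu.
      have := IHa mu _ y am' m'lt mu1 (le_lt_trans hm' m'lt).
      have := attempt_cost_start a_gt0 eta_gt0 am' m'lt mu1 etal.
      have := attempt_cost_potential a_gt0 eta_gt0 am' m'lt mu1 etal.
      have la : 0 <= ln a^-1 by apply: ln_ge0; rewrite invf_ge1.
      move=> h1 h2 h3.
      have nr : 1 - runmin mu y / mu <= noret Q mu (k + j) y.
        apply: le_trans (noret_ge _ _ Qh mu0).
        by rewrite lerD2l lerN2 ler_pM2r ?invr_gt0.
      have c0 : 0 <= C - potential a mu (runmin mu y) by lra.
      have := ler_wpM2l c0 nr.
      lra.
    rewrite -ltNge => etal.
    have := IHf _ y am' (le_trans m'm mu1); lra.
  apply: (le_trans (submarkov_le QP x step)).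
  rewrite (submarkovD QP) (submarkovZ QP).
  have := cst x; have := submarkov1 QP x; have := attempt_cost_ge1; nra.
have b0 : 0 < b := lt_trans (lt_le_trans a_gt0 amu) mub.
set W := fun y : S => win Q k (next_attempt (Some b) mu y) (runmin mu y) y.
have step y : ln (mu / runmin mu y) + gain Q k (runmin mu y) y
    <= C * W y - (C - potential a b mu) * noret Q b (k + j) y
       + (k%:R * eta + eta).
  have am' := runmin_ge mu y; have m'm := runmin_le y amu.
  have mu0 : 0 < mu := lt_le_trans a_gt0 amu.
  rewrite /W /=; case: ifPn => [hyb|].
    have m'b := le_lt_trans m'm mub.
    have h1 := IHa b _ y am' m'b b1 hyb.
    have h2 := potential_step a_gt0 am' m'm mub.
    have h3 := potential_mono a_gt0 am' m'm mub.
    (* At a new minimum [h y] is at most [runmin mu y], so success from [y] has probability at least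
       [1 - runmin mu y / b] and [potential_step] applies. *)
    have [m'lt|mm'] := ltrP (runmin mu y) mu; last first.
      have E : runmin mu y = mu by apply: le_anti; rewrite m'm mm'.
      by rewrite E divff ?gt_eqF // ln1 add0r in h1 *; lra.
    have nr : 1 - runmin mu y / b <= noret Q b (k + j) y.
      apply: le_trans (noret_ge _ _ Qh b0).
      by rewrite lerD2l lerN2 ler_pM2r ?invr_gt0 //; exact: runmin_lt.
    have : (potential a b mu - potential a b (runmin mu y)) * (1 - runmin mu y / b)
       <= (potential a b mu - potential a b (runmin mu y)) * noret Q b (k + j) y.
      by rewrite ler_wpM2l // subr_ge0.
    lra.
  (* The attempt fails: [noret] is [0] at [y], so the deduction vanishes, and the minimum is
     unchanged because [mu < b <= h y]. *)
  rewrite -leNgt => bhy.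
  have E : runmin mu y = mu by rewrite runmin_id //; lra.
  rewrite E divff ?gt_eqF // ln1 add0r.
  have nr0 : noret Q b (k + j) y = 0 by case: (k + j)%N => [|n] /=; rewrite ltNge bhy.
  have := IHf mu y amu ltac:(lra); rewrite nr0; lra.
apply: (le_trans (submarkov_le QP x step)).
rewrite (submarkovD QP) (submarkovB QP) !(submarkovZ QP) hb.
have := cst x; have := submarkov1 QP x; have := attempt_cost_ge1.
have := potential_ge0 a_gt0 amu mub.
rewrite -/W; nra.
Qed.

End OneOperator.

(** * Comparison of the killed walk with the unkilled one *)

Section Killing.
Variables (P : (S -> R) -> S -> R) (kap : S -> R).
Hypotheses (PP : submarkov P) (P1 : forall x, P (fun=> 1) x = 1).
Hypotheses (kap_ge0 : forall x, 0 <= kap x) (kap_le1 : forall x, kap x <= 1).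

Definition killed (f : S -> R) (x : S) : R := (1 - kap x) * P f x.

Lemma killed_submarkov : submarkov killed.
Proof.
split=> [f g c x|f g x fg|x]; rewrite /killed.
- by case: PP => -> _ _; ring.
- by rewrite ler_wpM2l ?subr_ge0 // (submarkov_le PP).
- by rewrite P1 mulr1 gerBl.
Qed.

Fixpoint survival (n : nat) : S -> R :=
  if n is n'.+1 then killed (survival n') else fun=> 1.

Fixpoint reach (n : nat) : S -> R :=
  if n is n'.+1 then P (reach n') else fun x => (h x <= a)%R%:R.

Lemma survival_ge0 n x : 0 <= survival n x.
Proof.
elim: n x => [|n IH] x //=; exact: (submarkov_ge0 killed_submarkov).
Qed.

Lemma survivalS n x : survival n.+1 x <= survival n x.
Proof.
elim: n x => [|n IH] x; first exact: (submarkov1 killed_submarkov).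
exact: (submarkov_le killed_submarkov).
Qed.

Lemma survival_nincr m n x : survival (m + n) x <= survival m x.
Proof.
elim: n => [|n IH]; first by rewrite addn0.
by rewrite addnS; apply: le_trans (survivalS _ _) IH.
Qed.

Lemma survival_le1 n x : survival n x <= 1.
Proof. exact: (survival_nincr 0). Qed.

Lemma reach_le1 n x : reach n x <= 1.
Proof.
elim: n x => [|n IH] x /=; first by rewrite lern1 leq_b1.
by rewrite -(P1 x); apply: (submarkov_le PP).
Qed.

(** Induction step shared by the comparisons below, with [s] a survival probability: being killed
    counts as success on the left and is absorbed by the loss of survival on the right. *)
Lemma kill_step (f g s : S -> R) x : (forall y, 0 <= g y) ->
  (forall y, f y <= g y + (1 - s y)) ->
  killed f x + (1 - killed (fun=> 1) x) <= P g x + (1 - killed s x).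
Proof.
move=> g0 fg; rewrite /killed P1.
have /(submarkov_le PP x) := fg.
rewrite (submarkovD PP) (submarkovB PP) P1 => h1.
have := submarkov_ge0 PP x g0; move: (kap_ge0 x) (kap_le1 x); nra.
Qed.

Lemma noret_kill b n x : noret killed b n x <= noret P b n x + (1 - survival n x).
Proof.
elim: n x => [|n IH] x /=; first by rewrite subrr addr0.
case: ifP => _; last by rewrite add0r subr_ge0 (survival_le1 n.+1).
rewrite P1 subrr addr0; apply: kill_step => // y; exact: noret_ge0.
Qed.

Lemma win_kill k mode mu x :
  win killed k mode mu x <= win P k mode mu x + (1 - survival (k + j) x).
Proof.
elim: k mode mu x => [|k IH] mode mu x /=.
  case: mode => [b|]; first exact: noret_kill.
  by rewrite add0r subr_ge0 survival_le1.
by rewrite P1 subrr addr0; apply: kill_step => // y; exact: win_ge0.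
Qed.

(** If [h <= a] after [k] steps, the floored minimum has come down to [a], a total drop of
    [ln (mu / a)]; killing spoils this with probability at most [1 - survival k x]. The upper bound
    on [mu] says that the minimum is consistent with the current value of [h]. *)
Lemma gain_kill k mu x : a <= mu -> mu <= Num.max a (h x) ->
  ln (mu / a) * (reach k x - (1 - survival k x)) <= gain killed k mu x.
Proof.
have a0 : 0 < a by [].
elim: k mu x => [|k IH] mu x amu mux /=.
  rewrite subrr subr0; have [ha|_] := lerP (h x) a; last by rewrite mulr0.
  rewrite (max_idPl ha) in mux.
  have -> : mu = a by apply: le_anti; rewrite mux.
  by rewrite divff ?gt_eqF // ln1 mul0r.
have mu0 : 0 < mu := lt_le_trans a0 amu.
set L := ln (mu / a).
have L0 : 0 <= L by apply: ln_ge0; rewrite ler_pdivlMr ?mul1r.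
have step y : L * (reach k y - (1 - survival k y)) <=
    ln (mu / runmin mu y) + gain killed k (runmin mu y) y.
  have h1 := IH _ y (runmin_ge mu y) (runmin_le_max mu y).
  have m0 := runmin_gt0 mu y.
  have E : L = ln (mu / runmin mu y) + ln (runmin mu y / a).
    by rewrite /L !ln_div ?posrE //; lra.
  have l0 : 0 <= ln (mu / runmin mu y).
    by apply: ln_ge0; rewrite ler_pdivlMr ?mul1r // runmin_le.
  rewrite E; have := reach_le1 k y; have := survival_le1 k y.
  move: h1 l0; set u := ln _; set v := ln _; nra.
apply: le_trans (submarkov_le killed_submarkov x step).
rewrite (submarkovZ killed_submarkov) ler_wpM2l //.
rewrite /killed (submarkovB PP) (submarkovB PP) P1.
have : P (reach k) x <= 1 := reach_le1 k.+1 x.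
by move: (kap_ge0 x) (kap_le1 x); nra.
Qed.

Hypothesis Qh : forall x, killed h x <= h x.

(** [gain_le_win] is applied to the killed walk, for which [h] is superharmonic; both sides are
    carried over to the unkilled walk at the price of the killing probability. *)
Lemma win_lower_bound k x mu : a <= mu -> mu <= 1 -> mu <= Num.max a (h x) ->
  k%:R * eta <= 1 ->
  ln (mu / a) * (reach k x - (1 - survival (k + j) x)) <=
  attempt_cost a eta * (win P k None mu x + (1 - survival (k + j) x)) + 1.
Proof.
move=> amu mu1 mux ke.
have L0 : 0 <= ln (mu / a) by apply: ln_ge0; rewrite ler_pdivlMr ?mul1r.
have h1 := gain_kill k amu mux.
have [h2 _] := gain_le_win killed_submarkov Qh k.
have h3 := h2 _ x amu mu1.
have h4 := win_kill k None mu x.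
have c0 : 0 <= attempt_cost a eta := le_trans ler01 attempt_cost_ge1.
have h5 := ler_wpM2l c0 h4.
have h6 : ln (mu / a) * (reach k x - (1 - survival (k + j) x)) <=
    ln (mu / a) * (reach k x - (1 - survival k x)).
  by rewrite ler_wpM2l //; have := survival_nincr k j x; lra.
lra.
Qed.

End Killing.
End Attempts.

(** * Expectations over finite paths *)

Definition stop (S : Type) (p : nat -> S) (n : nat) (y : S) : nat -> S :=
  fun i => if (i < n)%N then p i else y.

Definition agree (S : Type) (t : nat) (p q : nat -> S) : Prop :=
  forall i, (i <= t)%N -> p i = q i.

Definition determined (S U : Type) (t : nat) (F : (nat -> S) -> U) : Prop :=
  forall p q, agree t p q -> F p = F q.

Definition ind (R : realType) (B : Prop) : R := `[< B >]%:R.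

Section Indicator.
Variable R : realType.

Lemma ind_ge0 B : 0 <= ind R B.
Proof. exact: ler0n. Qed.

Lemma indT B : B -> ind R B = 1.
Proof. by move=> b; rewrite /ind asboolT. Qed.

Lemma indF B : ~ B -> ind R B = 0.
Proof. by move=> b; rewrite /ind asboolF. Qed.

Lemma ind_and A B : ind R (A /\ B) = ind R A * ind R B.
Proof.
have [a|a] := pselect A; last by rewrite (indF a) mul0r indF // => -[].
have [b|b] := pselect B; last by rewrite (indF b) mulr0 indF // => -[].
by rewrite !indT // mulr1.
Qed.

Lemma ind_le (A B : Prop) : (A -> B) -> ind R A <= ind R B.
Proof.
move=> AB; have [a|a] := pselect A; last by rewrite (indF a) ind_ge0.
by rewrite !indT //; exact: AB.
Qed.

End Indicator.

Lemma agree_sym (S : Type) t (p q : nat -> S) : agree t p q -> agree t q p.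
Proof. by move=> pq i it; rewrite pq. Qed.

Lemma agree_stop (S : Type) t (p : nat -> S) y : agree t (stop p t.+1 y) p.
Proof. by move=> i it; rewrite /stop ltnS it. Qed.

Lemma stop_last (S : Type) t (p : nat -> S) y : stop p t y t = y.
Proof. by rewrite /stop ltnn. Qed.

Section PathExpectation.
Variables (R : realType) (S : Type) (P : (S -> R) -> S -> R).
Hypotheses (PP : submarkov P) (P1 : forall x, P (fun=> 1) x = 1).
Implicit Types (F G : (nat -> S) -> R) (p q : nat -> S).

(** Conditional expectation given the history [p] up to time [t], over [k] further steps. It is
    meant for [F] determined by time [t + k]; the values that [stop] puts later are fillers. *)
Fixpoint pathE (k t : nat) F p : R :=
  if k is k'.+1 then P (fun y => pathE k' t.+1 F (stop p t.+1 y)) (p t)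
  else F p.

Lemma pathE_le k t F G p : (forall q, agree t q p -> F q <= G q) ->
  pathE k t F p <= pathE k t G p.
Proof.
elim: k t p => [|k IH] t p FG /=; first exact: FG.
apply: (submarkov_le PP) => y; apply: IH => q qp; apply: FG => i it.
by rewrite qp ?leqW //; exact: agree_stop.
Qed.

Lemma pathE_eq k t F G p : (forall q, agree t q p -> F q = G q) ->
  pathE k t F p = pathE k t G p.
Proof.
by move=> FG; apply: le_anti; rewrite !pathE_le // => q /FG ->.
Qed.

Lemma pathED k t F G p :
  pathE k t (fun q => F q + G q) p = pathE k t F p + pathE k t G p.
Proof.
elim: k t p => [|k IH] t p //=; rewrite -(submarkovD PP).
by congr (P _ _); apply/funext => y.
Qed.

Lemma pathEZ k t F a p : pathE k t (fun q => a * F q) p = a * pathE k t F p.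
Proof.
elim: k t p => [|k IH] t p //=; rewrite -(submarkovZ PP).
by congr (P _ _); apply/funext => y.
Qed.

Lemma pathE_cst k t a p : pathE k t (fun=> a) p = a.
Proof.
elim: k t p => [|k IH] t p //=.
rewrite (_ : (fun y : S => _) = fun=> a); last exact/funext.
by rewrite (submarkov_cst PP) P1 mulr1.
Qed.

Lemma pathE_ge0 k t F p : (forall q, 0 <= F q) -> 0 <= pathE k t F p.
Proof. by move=> F0; rewrite -(pathE_cst k t 0 p); apply: pathE_le. Qed.

Lemma pathE_determined k t F p : determined t F -> pathE k t F p = F p.
Proof.
by move=> dF; rewrite -[RHS](pathE_cst k t (F p) p); apply: pathE_eq => q /dF.
Qed.

Lemma pathE_tower k l t F p :
  pathE (k + l) t F p = pathE k t (fun q => pathE l (t + k) F q) p.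
Proof.
elim: k t p => [|k IH] t p /=; first by rewrite addn0.
by congr (P _ _); apply/funext => y; rewrite IH addSnnS.
Qed.

Lemma pathE_pull k t F G p : determined t F ->
  pathE k t (fun q => F q * G q) p = F p * pathE k t G p.
Proof.
by move=> dF; rewrite -pathEZ; apply: pathE_eq => q /dF ->.
Qed.

Variables (h : S -> R).

(** A cut seen through [h]. The horizon [T] keeps the event determined by a finite path. *)
Definition level_cut (T i : nat) p : Prop :=
  forall m l, (i <= m <= T)%N -> (l < i)%N -> h (p m) < h (p l).

Definition has_cut (t n T : nat) p : Prop :=
  exists i, (t < i <= n)%N /\ level_cut T i p.

Lemma noret_path b n t i p : (i <= t)%N ->
  (forall l, (l < i)%N -> b <= h (p l)) ->
  (forall m, (i <= m <= t)%N -> h (p m) < b) ->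
  noret h P b n (p t) <= pathE n t (fun q => ind R (level_cut (t + n) i q)) p.
Proof.
elim: n t p => [|n IH] t p it before after /=.
  rewrite after ?it ?leqnn // indT ?lexx // addn0 => m l im li.
  exact: lt_le_trans (after _ im) (before _ li).
rewrite after ?it ?leqnn // P1 subrr addr0; apply: (submarkov_le PP) => y.
have [hb|bh] := ltP (h y) b; last first.
  have -> : noret h P b n y = 0 by case: n {IH} => [|n] /=; rewrite ltNge bh.
  by apply: pathE_ge0 => q; exact: ind_ge0.
have := IH t.+1 (stop p t.+1 y); rewrite stop_last addSnnS; apply.
- exact: leqW.
- by move=> l li; rewrite agree_stop ?before //; lia.
move=> m /andP[im]; rewrite leq_eqVlt => /predU1P[->|mt]; first by rewrite stop_last.
by rewrite agree_stop // after // im.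
Qed.

Section AttemptPath.
Variables (a eta : R) (j t0 : nat).
Hypotheses (a_gt0 : 0 < a) (eta_gt0 : 0 < eta).

Definition attempt_inv (mode : option R) (t : nat) p : Prop :=
  if mode is Some b then
    exists i, [/\ (t0 < i <= t)%N, (forall l, (l < i)%N -> b <= h (p l)) &
      forall m, (i <= m <= t)%N -> h (p m) < b]
  else True.

(** Above the floor, [mu] is a lower bound for all past values of [h]. A new attempt needs a drop
    below [mu], hence [a < mu], so its level is at most the whole past and a success is a level
    cut. *)
Lemma win_path k mode mu t p : (t0 <= t)%N -> a <= mu ->
  (a < mu -> forall i, (i <= t)%N -> mu <= h (p i)) -> attempt_inv mode t p ->
  win h a eta j P k mode mu (p t) <=
  pathE (k + j) t (fun q => ind R (has_cut t0 (t + k) (t + k + j) q)) p.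
Proof.
elim: k mode mu t p => [|k IH] mode mu t p t0t amu muP inv /=.
  case: mode inv => [b|_]; last by apply: pathE_ge0 => q; exact: ind_ge0.
  case=> i [/andP[t0i it] before after].
  apply: le_trans (noret_path _ it before after) _; apply: pathE_le => q _.
  by apply: ind_le => H; exists i; rewrite t0i addn0.
rewrite P1 subrr addr0; apply: (submarkov_le PP) => y.
have m'm := runmin_le h y amu; have am' := runmin_ge h a mu y.
have := IH (next_attempt h a eta mode mu y) (runmin h a mu y) t.+1 (stop p t.+1 y).
rewrite stop_last addSnnS; apply.
- exact: leqW.
- by [].
- move=> am'lt i; rewrite leq_eqVlt => /predU1P[->|it].
    rewrite stop_last; move: am'lt; rewrite /runmin lt_max ltxx /= => am'lt.
    by rewrite ge_max ge_min lexx orbT andbT (le_trans (ltW am'lt)) // ge_min lexx orbT.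
  by rewrite agree_stop // (le_trans m'm) // muP // (lt_le_trans am'lt).
case: mode inv => [b [i [t0i before after]]|_] /=.
  case: ifPn => // hb; exists i; split.
  - by case/andP: t0i => -> /leqW.
  - by move=> l li; rewrite agree_stop ?before //; lia.
  move=> m /andP[im]; rewrite leq_eqVlt => /predU1P[->|mt]; first by rewrite stop_last.
  by rewrite agree_stop // after // im.
case: ifPn => // etal.
have mu0 : 0 < mu := lt_le_trans a_gt0 amu.
have m'lt : runmin h a mu y < mu.
  rewrite lt_neqAle m'm andbT; apply: contraTneq etal => ->.
  by rewrite divff ?gt_eqF // ln1 -ltNge.
exists t.+1; split; first by rewrite ltnS t0t leqnn.
- by move=> l; rewrite ltnS => lt; rewrite agree_stop // muP // (le_lt_trans am').
move=> m /andP[tm mt]; have -> : m = t.+1 by lia.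
by rewrite stop_last (le_lt_trans (runmin_lt amu m'lt)).
Qed.

End AttemptPath.

Lemma reach_path (a : R) k t p :
  pathE k t (fun q => ind R (h (q (t + k)%N) <= a)) p = reach h a P k (p t).
Proof.
elim: k t p => [|k IH] t p /=.
  by rewrite addn0 /ind; congr (_%:R); rewrite asboolb.
congr (P _ _); apply/funext => y; rewrite -[in RHS](stop_last t.+1 p y) -IH.
by rewrite addSnnS.
Qed.

Variable kap : S -> R.
Hypotheses (kap_ge0 : forall x, 0 <= kap x) (kap_le1 : forall x, kap x <= 1).

Definition killing_above (t T : nat) (e : R) p : Prop :=
  e < \sum_(t <= i < T) kap (p i).

(** Along a path the survival probability is the product of the factors [1 - kap], so death has
    probability at most the sum of [kap]. The induction treats [e] as a budget, reduced by [kap] at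
    each step. *)
Lemma survival_path n t (e : R) p : 0 <= e ->
  1 - survival P kap n (p t) <=
  e + pathE n t (fun q => ind R (killing_above t (t + n) e q)) p.
Proof.
elim: n t e p => [|n IH] t e p e0.
  by rewrite /= subrr addr_ge0 // ind_ge0.
(* If the first term alone exceeds the budget, the event on the right is certain. *)
have [ke|ek] := lerP (kap (p t)) e; last first.
  rewrite (@pathE_eq _ _ _ (fun=> 1)) => [|q qp].
    rewrite pathE_cst; have := survival_ge0 PP P1 kap_ge0 kap_le1 n.+1 (p t); lra.
  rewrite indT // /killing_above big_ltn; last by lia.
  rewrite qp // (lt_le_trans ek) // lerDl.
  by apply: sumr_ge0 => i _.
have IHn := IH t.+1 (e - kap (p t)).
set B := fun q => ind R (killing_above t.+1 (t.+1 + n) (e - kap (p t)) q).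
rewrite -/B in IHn.
have step y : 1 - survival P kap n y <= (e - kap (p t)) + pathE n t.+1 B (stop p t.+1 y).
  by have := IHn (stop p t.+1 y) ltac:(lra); rewrite stop_last.
have := submarkov_le PP (p t) step.
rewrite (submarkovB PP) (submarkovD PP) (submarkov_cst PP (e - kap (p t))) !P1 mulr1.
have -> : P (fun y => pathE n t.+1 B (stop p t.+1 y)) (p t) =
  pathE n.+1 t (fun q => ind R (killing_above t (t + n.+1) e q)) p.
  rewrite -[LHS]/(pathE n.+1 t B p); apply: pathE_eq => q qp.
  rewrite /B /killing_above; congr (ind R _).
  rewrite [in RHS]big_ltn; last by lia.
  by rewrite addSnnS qp // ltrBlDl.
set X := pathE _ _ _ _ => h1.
rewrite [survival _ _ _]/= /killed.
have : P (survival P kap n) (p t) <= 1.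
  by rewrite -(P1 (p t)); apply: (submarkov_le PP) => y; exact: survival_le1.
by move: (kap_ge0 (p t)) h1; nra.
Qed.

End PathExpectation.

(** * Lower bound for the probability of a new cut *)

Section CutBound.
Variables (R : realType) (S : Type) (P : (S -> R) -> S -> R) (kap h : S -> R).
Hypotheses (PP : submarkov P) (P1 : forall x, P (fun=> 1) x = 1).
Hypotheses (kap_ge0 : forall x, 0 <= kap x) (kap_le1 : forall x, kap x <= 1).
Hypothesis h_ge0 : forall x, 0 <= h x.
Hypothesis (Qh : forall x, killed P kap h x <= h x).

Definition descent (t n : nat) (p : nat -> S) : Prop :=
  (forall i, (i <= t)%N -> n%:R^-1 <= h (p i)) /\
  h (p (t + n ^ 6)%N) <= n%:R ^- 2.

(** [win_lower_bound] with [mu = 1 / n], [a = n ^ -2] and [eta = n ^ -6]: the drop is [l = ln n],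
    the attempt cost is [1 + 10 * l], and [l >= 1] bounds the quotient below by [1 / 11]. The free
    [j] lets the horizon grow later. *)
Lemma cut_bound n j t (e : R) (p : nat -> S) : 1 <= ln (n%:R : R) -> 0 <= e ->
  pathE P (n ^ 6 + j) t (fun q => ind R (descent t n q)) p / 11 <=
  pathE P (n ^ 6 + j) t
    (fun q => ind R (has_cut h t (t + n ^ 6) (t + n ^ 6 + j) q)) p
  + 2 * (e + pathE P (n ^ 6 + j) t
           (fun q => ind R (killing_above kap t (t + n ^ 6 + j) e q)) p)
  + (1 + 10 * ln (n%:R : R))^-1.
Proof.
move=> ln1n e0.
have n0 : 0 < n%:R :> R.
  by rewrite ltr0n lt0n; apply: contraTneq ln1n => ->; rewrite ln0 // -ltNge ltr01.
have n1 : 1 <= n%:R :> R by rewrite ler1n -(ltr0n R).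
set k := (n ^ 6)%N; set l := ln _ in ln1n *.
set W := pathE _ _ _ (fun q => ind R (has_cut _ _ _ _ _)) _.
set D := pathE _ _ _ (fun q => ind R (descent _ _ _)) _.
set K := pathE _ _ _ (fun q => ind R (killing_above _ _ _ _ _)) _.
have W0 : 0 <= W by apply: (pathE_ge0 PP P1) => q; exact: ind_ge0.
have K0 : 0 <= K by apply: (pathE_ge0 PP P1) => q; exact: ind_ge0.
have l0 : 0 <= (1 + 10 * l)^-1 by rewrite invr_ge0; lra.
have [lo|nlo] := pselect (forall i, (i <= t)%N -> n%:R^-1 <= h (p i)); last first.
  suff -> : D = 0 by lra.
  rewrite /D -(pathE_cst PP P1 (k + j) t 0 p); apply: (pathE_eq PP) => q qp.
  by apply: indF => -[dq _]; apply: nlo => i it; rewrite -qp ?dq.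
pose a : R := n%:R ^- 2; pose eta : R := k%:R^-1.
have a0 : 0 < a by rewrite invr_gt0 exprn_gt0.
have a1 : a <= 1 by rewrite invf_le1 ?exprn_gt0 // exprn_ege1.
have k0 : 0 < k%:R :> R by rewrite natrX exprn_gt0.
have eta0 : 0 < eta by rewrite invr_gt0.
have eta1 : eta <= 1 by rewrite invf_le1 // natrX exprn_ege1.
have an : a <= n%:R^-1.
  by rewrite lef_pV2 ?posrE ?exprn_gt0 // expr2 ler_pMl.
have amu : n%:R^-1 <= 1 :> R by rewrite invf_le1.
have := @win_lower_bound R S h a eta j h_ge0 a0 a1 eta0 eta1 P kap PP P1
   kap_ge0 kap_le1 Qh k (p t) n%:R^-1 an amu.
have ke : k%:R * eta <= 1 by rewrite /eta divff ?gt_eqF.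
rewrite le_max lo // orbT ke => /(_ isT isT).
have -> : ln (n%:R^-1 / a) = l.
  by congr ln; rewrite /a invrK expr2 mulrA mulVf ?gt_eqF // mul1r.
have -> : attempt_cost a eta = 1 + 10 * l.
  by rewrite /attempt_cost /a /eta !invrK natrX !lnXn // -/l; ring.
set w := win _ _ _ _ _ _ _ _ _; set r := reach _ _ _ _ _.
have w0 : 0 <= w by exact: win_ge0.
have wW : w <= W.
  apply: (win_path PP P1 j a0 eta0 k (leqnn t) an (mode := None)) => //.
have Dr : D <= r.
  rewrite /r -(reach_path P h a k t p) /D (pathE_tower P k j).
  apply: (pathE_le PP) => q qp.
  rewrite (pathE_determined PP P1); last first.
    move=> q1 q2 q12; congr (ind R _); rewrite /descent q12 // propeqE.
    split=> -[H1 H2]; split=> // i it; [rewrite -q12|rewrite q12]; rewrite ?H1 //;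
      exact: leq_trans it (leq_addr _ _).
  by apply: ind_le => -[].
have r1 : r <= 1 by exact: reach_le1.
have sK : 1 - survival P kap (k + j) (p t) <= e + K.
  by have := survival_path PP P1 kap_ge0 kap_le1 (k + j) t p e0; rewrite addnA.
set s := survival _ _ _ _ in sK *.
have s1 : s <= 1 by exact: survival_le1.
set c := 1 + 10 * l.
have c0 : 0 < c by rewrite /c; lra.
move=> main.
(* [c <= 11 * l] replaces [l] by [c / 11] when the factor is nonnegative; otherwise the left side is
   negative. *)
have {}main : c / 11 * (r - (1 - s)) <= c * (w + (1 - s)) + 1.
  have [rs|rs] := lerP 0 (r - (1 - s)).
    apply: (le_trans _ main); rewrite ler_wpM2r //; rewrite /c; lra.
  have : 0 <= c * (w + (1 - s)) by rewrite mulr_ge0 //; lra.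
  nra.
have : (r - (1 - s)) / 11 <= w + (1 - s) + c^-1.
  rewrite -(ler_pM2l c0) mulrDr divff ?gt_eqF //; lra.
move: l0; rewrite -/c; lra.
Qed.

(** The conditional bound at time [t] is averaged over histories; the indicator of [Ap], known at
    time [t], comes out of the conditional expectation. *)
Lemma cut_bound0 n j t T (e : R) (Ap : (nat -> S) -> Prop) (p : nat -> S) :
  determined t Ap -> 1 <= ln (n%:R : R) -> 0 <= e ->
  T = (t + n ^ 6 + j)%N ->
  pathE P T 0 (fun q => ind R (Ap q /\ descent t n q)) p / 11 <=
  pathE P T 0 (fun q => ind R (Ap q /\ has_cut h t (t + n ^ 6) T q)) p
  + 2 * (e + pathE P T 0 (fun q => ind R (killing_above kap t T e q)) p)
  + (1 + 10 * ln (n%:R : R))^-1.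
Proof.
move=> dA ln1n e0 TE.
have dA' : determined t (fun q => ind R (Ap q)) by move=> q1 q2 /dA ->.
have tow F : pathE P T 0 F p = pathE P t 0 (fun q => pathE P (n ^ 6 + j) t F q) p.
  by rewrite TE -addnA pathE_tower.
have towA (B : (nat -> S) -> Prop) : pathE P T 0 (fun q => ind R (Ap q /\ B q)) p =
  pathE P t 0 (fun q => ind R (Ap q) * pathE P (n ^ 6 + j) t (fun q => ind R (B q)) q) p.
  rewrite tow; congr (pathE _ _ _ _ _); apply/funext => q.
  rewrite -(pathE_pull PP _ _ _ dA'); congr (pathE _ _ _ _ _).
  by apply/funext => q'; rewrite ind_and.
rewrite !towA tow mulrC -(pathEZ PP) -[leRHS]addrA.
have -> : 2 * (e + pathE P t 0 (fun q => pathE P (n ^ 6 + j) t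
     (fun q0 => ind R (killing_above kap t T e q0)) q) p) + (1 + 10 * ln n%:R)^-1 =
   pathE P t 0 (fun q => 2 * (e + pathE P (n ^ 6 + j) t
     (fun q0 => ind R (killing_above kap t T e q0)) q) + (1 + 10 * ln n%:R)^-1) p.
  by rewrite (pathED PP) (pathE_cst PP P1) (pathEZ PP) (pathED PP) (pathE_cst PP P1).
rewrite -(pathED PP); apply: (pathE_le PP) => q _.
have := cut_bound j t q ln1n e0; rewrite -TE.
have K0 : 0 <= pathE P (n ^ 6 + j) t (fun q0 => ind R (killing_above kap t T e q0)) q.
  by apply: (pathE_ge0 PP P1) => q'; exact: ind_ge0.
have l0 : 0 <= (1 + 10 * ln (n%:R : R))^-1 by rewrite invr_ge0; lra.
have [aq|aq] := pselect (Ap q); first by rewrite indT // !mul1r; lra.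
by rewrite indF // !mul0r; lra.
Qed.

End CutBound.

(** * The transition operator of a network and the energy estimate *)

Section Network.
Variables (R : realType) (N : network R).
Local Notation V := (nV N).
Local Notation E := (nE N).
Hypothesis LF : locally_finite N.

Definition outs (u : V) : seq E := finmap.enum_fset (fset_set (out_edges N u)).

Lemma mem_outs u e : (e \in outs u) = `[< src e = u >].
Proof.
rewrite in_fset_set; last exact: LF.
by apply/idP/asboolP; rewrite inE.
Qed.

Lemma outs_uniq u : uniq (outs u).
Proof. exact: finmap.fset_uniq. Qed.

Lemma cvertE u : cvert N u = \sum_(e <- outs u) cond e.
Proof. by rewrite /cvert fsbig_finite //; exact: LF. Qed.

Lemma outs_src u e : e \in outs u -> src e = u.
Proof. by rewrite mem_outs => /asboolP. Qed.

Lemma cvert_ge0 u : 0 <= cvert N u.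
Proof. by rewrite cvertE; apply: sumr_ge0 => e _; exact: ltW (cond_gt0 _). Qed.

Definition step (f : V -> R) (u : V) : R :=
  (\sum_(e <- outs u) cond e * f (tgt e)) / cvert N u.

Lemma step_submarkov (c_gt0 : forall u, 0 < cvert N u) : submarkov step.
Proof.
split=> [f g a x|f g x fg|x]; rewrite /step.
- rewrite mulrA -mulrDl mulr_sumr -big_split /=; congr (_ / _).
  by apply: eq_bigr => e _; ring.
- rewrite ler_pM2r ?invr_gt0 //; apply: ler_sum => e _.
  by rewrite ler_wpM2l // ltW // cond_gt0.
under eq_bigr do rewrite mulr1.
by rewrite -cvertE divff ?gt_eqF.
Qed.

Lemma step1 (c_gt0 : forall u, 0 < cvert N u) u : step (fun=> 1) u = 1.
Proof.
rewrite /step; under eq_bigr do rewrite mulr1.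
by rewrite -cvertE divff ?gt_eqF.
Qed.

Section Energy.
Variables (o : V) (g k u : V -> R) (B : R) (l : seq {classic V}).
Hypotheses (l_uniq : uniq l) (u_supp : forall x : V, u x != 0 -> (x : {classic V}) \in l).
Hypotheses (u_ge0 : forall x, 0 <= u x) (g_gt0 : forall x, 0 < g x).
Hypothesis (B_ge0 : 0 <= B).
Hypothesis g_slow : forall e : E,
  g (src e) ^+ 2 + g (tgt e) ^+ 2 <= (2 + k (src e)) * (g (src e) * g (tgt e)).
Hypothesis u_sub : forall x,
  (1 + k x) * cvert N x * u x - \sum_(e <- outs x) cond e * u (tgt e) <=
  B * ind R (x = o).

(** [L] joins to the edges leaving [l] their reversals, so that sums over it can be symmetrised. *)
Let L0 : seq E := flatten [seq outs x | x <- l].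
Let L : seq E := undup (L0 ++ map (@erev _ N) L0).

Let erev_L e : e \in L -> erev e \in L.
Proof.
rewrite !mem_undup !mem_cat => /orP[eL|/mapP[f fL ->]]; last by rewrite erevK fL.
by rewrite map_f ?orbT.
Qed.

Let perm_L : perm_eq L (map (@erev _ N) L).
Proof.
apply: uniq_perm; rewrite ?undup_uniq // ?map_inj_uniq ?undup_uniq //.
  exact: can_inj (@erevK _ N).
move=> e; apply/idP/mapP => [eL|[f fL ->]]; last exact: erev_L.
by exists (erev e); rewrite ?erevK //; exact: erev_L.
Qed.

Let sum_erev (F : E -> R) : \sum_(e <- L) F e = \sum_(e <- L) F (erev e).
Proof. by rewrite (perm_big _ perm_L) big_map. Qed.

Let sum_src (F : E -> R) : (forall e, u (src e) = 0 -> F e = 0) ->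
  \sum_(x <- l) \sum_(e <- outs x) F e = \sum_(e <- L) F e.
Proof.
move=> F0.
pose s (e : E) : {classic V} := src e.
transitivity (\sum_(x <- l) \sum_(e <- L | s e == x) F e).
  rewrite big_seq [RHS]big_seq; apply: eq_bigr => x xl.
  rewrite -[RHS]big_filter; apply: perm_big; apply: uniq_perm.
  - exact: outs_uniq.
  - by rewrite filter_uniq ?undup_uniq.
  move=> e; rewrite mem_filter mem_outs; apply/asboolP/andP => [ex|[/eqP]//].
  split; first exact/eqP.
  rewrite mem_undup mem_cat; apply/orP; left; apply/flattenP.
  by exists (outs x); [exact: map_f | rewrite mem_outs; exact/asboolP].
rewrite (exchange_big_dep predT) //=; apply: eq_bigr => e _.
have [u0|u0] := eqVneq (u (src e)) 0; first by rewrite F0 // big1.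
rewrite -big_filter.
have -> : [seq x <- l | s e == x] = [:: s e].
  rewrite -(@eq_filter _ (pred1 (s e))); last by move=> x /=; rewrite eq_sym.
  by rewrite filter_pred1_uniq ?u_supp.
by rewrite big_seq1.
Qed.

(** Test the inequality for [u] against [g ^ 2 * u] and add the two orientations of each edge. By
    [g_slow] and the inequality of means, the mixed term [(g1 ^ 2 + g2 ^ 2) * u1 * u2] is at most
    [(1 + k1 / 2) * (g1 * u1) ^ 2 + (1 + k2 / 2) * (g2 * u2) ^ 2], so half of the killing term
    survives; only its part at [x] is kept. *)
Lemma energy_bound (x : V) : (forall x, 0 <= k x) ->
  cvert N x * (k x / 2) * (g x * u x) ^+ 2 <= B * (g o ^+ 2 * u o).
Proof.
move=> k_ge0.
have [->|ux] := eqVneq (u x) 0.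
  by rewrite mulr0 expr0n mulr0 mulr_ge0 // mulr_ge0 // exprn_ge0 // ltW.
pose T (e : E) := cond e * ((1 + k (src e)) * (g (src e) * u (src e)) ^+ 2
  - g (src e) ^+ 2 * u (src e) * u (tgt e)).
pose W (e : E) := cond e * (k (src e) / 2 * (g (src e) * u (src e)) ^+ 2).
have WT : \sum_(e <- L) W e <= \sum_(e <- L) T e.
  have dbl (F : E -> R) : 2 * \sum_(e <- L) F e = \sum_(e <- L) (F e + F (erev e)).
    by rewrite big_split /= -(sum_erev F); ring.
  rewrite -(@ler_pM2l _ 2) // !dbl; apply: ler_sum => e _.
  rewrite /W /T cond_erev src_erev tgt_erev -!mulrDr ler_wpM2l ?(ltW (cond_gt0 _)) //.
  have h1 := g_slow e; have h2 := g_slow (erev e); rewrite src_erev tgt_erev in h2.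
  move: (u_ge0 (src e)) (u_ge0 (tgt e)) (g_gt0 (src e)) (g_gt0 (tgt e)) h1 h2.
  move: (k_ge0 (src e)) (k_ge0 (tgt e)).
  set k1 := k (src e); set k2 := k (tgt e); set u1 := u (src e).
  set u2 := u (tgt e); set g1 := g (src e); set g2 := g (tgt e).
  move=> k10 k20 u10 u20 g10 g20 h1 h2.
  pose c := (g1 ^+ 2 + g2 ^+ 2) / (g1 * g2).
  have g12 : 0 < g1 * g2 by rewrite mulr_gt0.
  have c1 : c <= 2 + k1 by rewrite ler_pdivrMr.
  have c2 : c <= 2 + k2 by rewrite ler_pdivrMr //; lra.
  have c0 : 0 <= c by rewrite divr_ge0 ?addr_ge0 ?sqr_ge0 // ltW.
  have cE : (g1 ^+ 2 + g2 ^+ 2) * (u1 * u2) = c * ((g1 * u1) * (g2 * u2)).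
    by rewrite /c; field; rewrite !gt_eqF.
  have : c * ((g1 * u1) * (g2 * u2)) <= c * ((g1 * u1) ^+ 2 + (g2 * u2) ^+ 2) / 2.
    rewrite -[leRHS]mulrA ler_wpM2l //; have := sqr_ge0 (g1 * u1 - g2 * u2).
    by rewrite sqrrB mulr2n; lra.
  have := ler_wpM2r (sqr_ge0 (g1 * u1)) c1.
  have := ler_wpM2r (sqr_ge0 (g2 * u2)) c2.
  rewrite -cE; lra.
have Wl : \sum_(e <- L) W e = \sum_(y <- l) cvert N y * (k y / 2) * (g y * u y) ^+ 2.
  rewrite -sum_src => [|e ue]; last by rewrite /W ue mulr0 expr0n !mulr0.
  apply: eq_bigr => y _; rewrite cvertE -mulrA mulr_suml big_seq [RHS]big_seq.
  by apply: eq_bigr => e /outs_src ey; rewrite /W ey.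
have Tl : \sum_(e <- L) T e = \sum_(y <- l) g y ^+ 2 * u y *
   ((1 + k y) * cvert N y * u y - \sum_(e <- outs y) cond e * u (tgt e)).
  rewrite -sum_src => [|e ue]; last by rewrite /T ue !mulr0 expr0n !mulr0 mul0r subrr mulr0.
  apply: eq_bigr => y _.
  rewrite cvertE (mulrAC (1 + k y)) mulr_sumr -sumrB mulr_sumr big_seq [RHS]big_seq.
  by apply: eq_bigr => e /outs_src ey; rewrite /T ey; ring.
apply: (@le_trans _ _ (\sum_(e <- L) W e)).
  rewrite Wl (big_rem _ (u_supp ux)) /= lerDl; apply: sumr_ge0 => y _.
  by rewrite mulr_ge0 ?sqr_ge0 // mulr_ge0 ?cvert_ge0 // divr_ge0.
apply: (le_trans WT); rewrite Tl.
apply: (@le_trans _ _ (\sum_(y <- l) g y ^+ 2 * u y * (B * ind R ((y : V) = o)))).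
  apply: ler_sum => y _; rewrite ler_wpM2l // mulr_ge0 // exprn_ge0 //.
  exact: ltW.
have [ol|ol] := boolP ((o : {classic V}) \in l).
  rewrite (big_rem _ ol) /= indT // mulr1 mulrC gerDl big_seq big1 // => y.
  rewrite mem_rem_uniq // inE => /andP[/eqP yo _].
  by rewrite indF // !mulr0.
rewrite big_seq big1 => [|y yl]; first by rewrite mulr_ge0 // mulr_ge0 // exprn_ge0 // ltW.
by rewrite indF ?mulr0 // => yo; rewrite -yo yl in ol.
Qed.

End Energy.
End Network.

(** * Graph distance *)

Section Distance.
Variables (R : realType) (N : network R).
Hypothesis CN : connected_net N.

Lemma gdist_path (u v : nV N) : path_len N (gdist N u v) u v.
Proof.
rewrite /gdist; case: pselect => [H|H]; first by case: ex_minnP => k /asboolP.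
by case: H; have [k kP] := CN u v; exists k; exact/asboolP.
Qed.

Lemma gdist_le (k : nat) (u v : nV N) : path_len N k u v -> (gdist N u v <= k)%N.
Proof.
move=> kP; rewrite /gdist; case: pselect => [H|H].
  by case: ex_minnP => m _; apply; exact/asboolP.
by case: H; exists k; exact/asboolP.
Qed.

Lemma gdistxx (u : nV N) : gdist N u u = 0%N.
Proof.
by apply/eqP; rewrite -leqn0; apply: gdist_le; exists (fun=> u); split.
Qed.

Lemma gdist_tgt (u : nV N) (e : nE N) : (gdist N u (tgt e) <= (gdist N u (src e)).+1)%N.
Proof.
have [x [x0 xk xP]] := gdist_path u (src e); set k := gdist N u (src e) in xk xP *.
apply: gdist_le; exists (stop x k.+1 (tgt e)); split.
- by rewrite /stop.
- by rewrite stop_last.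
move=> i; rewrite ltnS /stop leq_eqVlt => /predU1P[->|ik].
  by rewrite ltnn ltnSn xk; exists e.
by rewrite !ltnS ik ltnW //; exact: xP.
Qed.

Lemma gdist_src (u : nV N) (e : nE N) : (gdist N u (src e) <= (gdist N u (tgt e)).+1)%N.
Proof. by have := gdist_tgt u (erev e); rewrite src_erev tgt_erev. Qed.

End Distance.

(** * Green function of the killed walk *)

Section Green.
Variables (R : realType) (N : network R).
Local Notation V := (nV N).
Hypotheses (LF : locally_finite N) (CN : connected_net N).
Variable c0 : R.
Hypotheses (c0_gt0 : 0 < c0) (c0_le : forall u, c0 <= cvert N u).
Variable o : V.

Let c_gt0 u : 0 < cvert N u := lt_le_trans c0_gt0 (c0_le u).
Let PP : submarkov (@step R N) := step_submarkov LF c_gt0.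
Let P1 := step1 LF c_gt0.

(* Shifted by one so as to be positive at [o]. *)
Definition dist1 (x : V) : R := (gdist N o x).+1%:R.

(** Chosen so that [1 / (1 - kill_rate x) = 1 + 9 / dist1 x ^ 2], which puts the equation of the
    killed walk in the form used by the energy bound. *)
Definition kill_rate (x : V) : R := 9 / (dist1 x ^+ 2 + 9).

Lemma dist1_ge1 x : 1 <= dist1 x.
Proof. by rewrite ler1n. Qed.

Lemma kill_rate_ge0 x : 0 <= kill_rate x.
Proof. by rewrite divr_ge0 // addr_ge0 // sqr_ge0. Qed.

Lemma kill_rate_le1 x : kill_rate x <= 1.
Proof.
have := sqr_ge0 (dist1 x) => h.
by rewrite ler_pdivrMr ?mul1r ?lerDr // ltr_wpDl.
Qed.

Let Q := killed (@step R N) kill_rate.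
Let QP : submarkov Q := killed_submarkov PP P1 kill_rate_ge0 kill_rate_le1.

(** Expected number of visits to [o] before time [n] by the killed walk from [x]; truncation gives
    the finite support that the energy bound requires. *)
Fixpoint green (n : nat) (x : V) : R :=
  if n is n'.+1 then ind R (x = o) + Q (green n') x else 0.

Lemma green_ge0 n x : 0 <= green n x.
Proof.
by case: n x => [|n] x //=; elim: n x => [|n IH] x /=;
  rewrite addr_ge0 ?ind_ge0 // (submarkov_ge0 QP).
Qed.

Lemma greenS n x : green n x <= green n.+1 x.
Proof.
elim: n x => [|n IH] x; first exact: green_ge0.
by rewrite /= lerD2l (submarkov_le QP).
Qed.

Lemma green_ndecr m n x : (m <= n)%N -> green m x <= green n x.
Proof.
by move=> /subnK <-; elim: (n - m)%N => // k IH; apply: le_trans IH (greenS _ _).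
Qed.

Lemma green_supp n : exists l : seq {classic V}, uniq l /\
  forall x : V, green n x != 0 -> (x : {classic V}) \in l.
Proof.
elim: n => [|n [l [_ lP]]]; first by exists [::]; split=> // x; rewrite eqxx.
exists (undup ((o : {classic V}) ::
  [seq (tgt e : {classic V}) | e <- flatten [seq outs y | y <- l]])).
split=> [|x]; first exact: undup_uniq.
rewrite mem_undup inE /=; have [->|xo] := pselect (x = o); first by rewrite eqxx.
rewrite indF // add0r => Qx; apply/orP; right.
have [e ex ge] : exists2 e, e \in outs x & green n (tgt e) != 0.
  apply: contrapT => H; move: Qx; rewrite /Q /killed /step big_seq big1 ?mul0r ?mulr0 ?eqxx //.
  move=> e ex; have [->|g0] := eqVneq (green n (tgt e)) 0; first by rewrite mulr0.
  by case: H; exists e.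
apply/mapP; exists (erev e); last by rewrite tgt_erev (outs_src LF ex).
apply/flattenP; exists (outs (tgt e)); first by apply: (@map_f {classic V} _ (fun y => outs (y : V))); exact: lP.
by rewrite (mem_outs LF) src_erev; exact/asboolP.
Qed.

(** From [w ^ 2 <= (400 / 81) * (cvert N o / c0)] for [w = dist1 x * green n x], with
    [400 / 81 <= 5] and [w <= 1 + w ^ 2]. *)
Let M : R := 1 + 5 * (cvert N o / c0).

Let M_gt0 : 0 < M.
Proof. by rewrite /M ltr_pwDl // mulr_ge0 // divr_ge0 // ltW. Qed.

(** [energy_bound] with [g = dist1 ^ 2] and [k = 9 / dist1 ^ 2]. Monotonicity in [n] gives the
    required inequality for [green n], with source [(1 + k o) * cvert N o = 10 * cvert N o]. *)
Lemma green_energy n x :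
  cvert N x * (9 / 2 * (dist1 x * green n x) ^+ 2) <= 10 * cvert N o * green n o.
Proof.
have [l [ul lP]] := green_supp n.
pose k y := 9 / dist1 y ^+ 2.
have d0 y : 0 < dist1 y := lt_le_trans ltr01 (dist1_ge1 y).
have k0 y : 0 <= k y by rewrite divr_ge0 // sqr_ge0.
have do1 : dist1 o = 1 by rewrite /dist1 gdistxx.
have := @energy_bound R N LF o (fun y => dist1 y ^+ 2) k (green n) (10 * cvert N o) l
  ul lP (green_ge0 n) _ _ _ _ x k0.
rewrite do1 !expr1n mul1r => H.
have -> : cvert N x * (9 / 2 * (dist1 x * green n x) ^+ 2) =
  cvert N x * (k x / 2) * (dist1 x ^+ 2 * green n x) ^+ 2.
  by rewrite /k; field; rewrite gt_eqF.
apply: H => [y||e|y].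
- by rewrite exprn_gt0.
- by rewrite mulr_ge0 // ltW.
- have h1 : dist1 (src e) <= dist1 (tgt e) + 1.
    by rewrite /dist1 natr1 ler_nat ltnS gdist_src.
  have h2 : dist1 (tgt e) <= dist1 (src e) + 1.
    by rewrite /dist1 natr1 ler_nat ltnS gdist_tgt.
  have := d0 (src e); have := dist1_ge1 (tgt e); have := d0 (tgt e).
  move: h1 h2; rewrite /k; set a := dist1 _; set b := dist1 _ => h1 h2 b0 b1 a0.
  have -> : (2 + 9 / a ^+ 2) * (a ^+ 2 * b ^+ 2) = 2 * (a ^+ 2 * b ^+ 2) + 9 * b ^+ 2.
    by field; rewrite gt_eqF.
  (* The constant [9] comes from [a + b <= 2 * b + 1 <= 3 * b], so that
     [(a ^ 2 - b ^ 2) ^ 2 <= 9 * b ^ 2]. *)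
  have s1 : (a - b) ^+ 2 <= 1 by nra.
  have s2 : (a + b) ^+ 2 <= 9 * b ^+ 2 by nra.
  have := ler_wpM2r (sqr_ge0 (a + b)) s1; lra.
have Qy : Q (green n) y = (\sum_(e <- outs y) cond e * green n (tgt e))
    / ((1 + k y) * cvert N y).
  rewrite /Q /killed /step /kill_rate /k; field.
  by rewrite !gt_eqF // ?ltr_wpDl ?sqr_ge0.
have ky : 0 < (1 + k y) * cvert N y by rewrite mulr_gt0 // ltr_pwDl.
have -> : \sum_(e <- outs y) cond e * green n (tgt e) =
   (1 + k y) * cvert N y * Q (green n) y.
  by rewrite Qy mulrC divfK // gt_eqF.
rewrite -mulrBr.
have := greenS n y; rewrite /= => gS.
have [yo|yo] := pselect (y = o).
  move: gS; rewrite indT // mulr1 yo => gS.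
  have -> : 1 + k o = 10 by rewrite /k do1 expr1n divr1; lra.
  by rewrite ger_pMr ?mulr_gt0 //; lra.
rewrite indF // in gS *; rewrite mulr0.
by rewrite pmulr_rle0 // subr_le0; lra.
Qed.

(** At [o] the energy bound is quadratic against linear in [green n o] and gives [20 / 9]; fed back
    at [x], with [c0 <= cvert N x], it controls [dist1 x * green n x] uniformly in [n]. *)
Lemma green_le n x : green n x <= M / dist1 x.
Proof.
have d0 : 0 < dist1 x := lt_le_trans ltr01 (dist1_ge1 x).
have go : green n o <= 20 / 9.
  have := green_energy n o; rewrite {1}/dist1 gdistxx mul1r.
  have := green_ge0 n o; have := c_gt0 o; set a := green _ _; set c := cvert _ _.
  move=> cp a0; rewrite (_ : 10 * c * a = c * (10 * a)); last by ring.
  rewrite ler_pM2l // => H.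
  have [->|an] := eqVneq a 0; first by lra.
  have ap : 0 < a by rewrite lt_neqAle eq_sym an.
  by rewrite -(ler_pM2r ap); lra.
have := green_energy n x; have g0 := green_ge0 n x.
move=> H; rewrite ler_pdivlMr // mulrC; set w := dist1 x * green n x in H *.
have w0 : 0 <= w by rewrite mulr_ge0 // ltW.
have w2 : w ^+ 2 <= 5 * (cvert N o / c0).
  rewrite mulrA ler_pdivlMr //.
  have h1 : c0 * w ^+ 2 <= cvert N x * w ^+ 2 by rewrite ler_wpM2r ?sqr_ge0.
  have h2 : cvert N o * green n o <= cvert N o * (20 / 9) by rewrite ler_wpM2l // ltW.
  have := c_gt0 o; lra.
rewrite /M; move: w2; set q := 5 * _; nra.
Qed.

Let green_ub x : has_sup (range (green ^~ x)).
Proof.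
split; first by exists (green 0 x), 0%N.
by exists (M / dist1 x) => _ [n _ <-]; exact: green_le.
Qed.

Definition green_lim (x : V) : R := sup (range (green ^~ x)).

Let green_le_lim n x : green n x <= green_lim x.
Proof. by apply: sup_upper_bound; [exact: green_ub | exists n]. Qed.

(** A vertex has finitely many neighbours, so one [n] brings [green n] within [eps] of the limit at
    all of them, and [Q (green n) <= green n.+1]. *)
Let green_lim_super x : Q green_lim x <= green_lim x.
Proof.
apply/ler_addgt0Pr => eps eps0.
have [n nP] : exists n, forall e, e \in outs x ->
    green_lim (tgt e) <= green n (tgt e) + eps.
  elim: (outs x) => [|f r [n nP]]; first by exists 0%N.
  have [_ [m _ <-] mP] := sup_adherent eps0 (green_ub (tgt f)).
  exists (maxn m n) => e; rewrite inE => /predU1P[->|er].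
    have := green_ndecr (tgt f) (leq_maxl m n); rewrite -/(green_lim _) in mP; lra.
  have := green_ndecr (tgt e) (leq_maxr m n); have := nP e er; lra.
have Pn : step green_lim x <= step (fun y => green n y + eps) x.
  rewrite /step ler_pM2r ?invr_gt0 // big_seq [leRHS]big_seq; apply: ler_sum => e ex.
  by rewrite ler_wpM2l ?(ltW (cond_gt0 _)) // nP.
have : Q green_lim x <= Q (fun y => green n y + eps) x.
  by rewrite /Q /killed ler_wpM2l // subr_ge0 kill_rate_le1.
rewrite (submarkovD QP) (submarkov_cst QP) => h1.
have h2 : eps * Q (fun=> 1) x <= eps by rewrite ger_pMr // (submarkov1 QP).
have h3 := green_le_lim n.+1 x; rewrite /= in h3.
have := ind_ge0 R (x = o); lra.
Qed.

(** Positivity spreads along a path from [o]: the killed walk steps back from [p k.+1] to [p k] with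
    positive probability, and [green_lim] is superharmonic. *)
Let green_lim_gt0 x : 0 < green_lim x.
Proof.
have [k [p [p0 pk pP]]] := CN o x.
rewrite -pk; elim: k {pk} pP => [|k IH] pP.
  apply: lt_le_trans (green_le_lim 1 _).
  by rewrite /= p0 indT // ltr_pwDl // (submarkov_ge0 QP).
have {}IH : 0 < green_lim (p k) by apply: IH => i ik; apply: pP; exact: leqW.
have [e [es et]] := pP k (ltnSn k).
apply: lt_le_trans (green_lim_super _).
have k1 : kill_rate (p k.+1) < 1.
  by rewrite ltr_pdivrMr ?mul1r ?ltrDr ?exprn_gt0 ?ltr_wpDl ?sqr_ge0 // (lt_le_trans ltr01) ?dist1_ge1.
rewrite /Q /killed /step mulr_gt0 ?subr_gt0 // divr_gt0 //.
have ein : erev e \in outs (p k.+1).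
  by rewrite (mem_outs LF) src_erev et; exact/asboolP.
rewrite (big_rem _ ein) /= ltr_pwDl //.
  by rewrite mulr_gt0 ?cond_gt0 // tgt_erev es.
apply: sumr_ge0 => f _; rewrite mulr_ge0 ?(ltW (cond_gt0 _)) //.
exact: le_trans (green_ge0 0 _) (green_le_lim 0 _).
Qed.

Lemma superharmonic_exists : exists h : V -> R,
  [/\ forall x, 0 < h x, forall x, h x <= (dist1 x)^-1 &
      forall x, killed (@step R N) kill_rate h x <= h x].
Proof.
exists (fun x => M^-1 * green_lim x); split=> x.
- by rewrite mulr_gt0 ?invr_gt0.
- rewrite mulrC ler_pdivrMr // mulrC; apply: ge_sup; first by exists (green 0 x), 0%N.
  by move=> _ [n _ <-]; exact: green_le.
by rewrite -/Q (submarkovZ QP) ler_wpM2l // invr_ge0 ltW.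
Qed.

End Green.

(** * Real-valued probabilities and continuity of measure *)

Section RealProbability.
Context d (Omega : measurableType d) (R : realType) (P : probability Omega R).
Implicit Types A B : set Omega.

Definition pr A : R := fine (P A).

Lemma prE A : measurable A -> P A = (pr A)%:E.
Proof. by move=> mA; rewrite /pr fineK // fin_num_measure. Qed.

Lemma pr_ge0 A : 0 <= pr A.
Proof. exact: fine_ge0. Qed.

Lemma pr_le A B : measurable A -> measurable B -> A `<=` B -> pr A <= pr B.
Proof. by move=> mA mB AB; rewrite -lee_fin -!prE // le_measure // inE. Qed.

Lemma pr_le1 A : measurable A -> pr A <= 1.
Proof. by move=> mA; rewrite -lee_fin -prE // probability_le1. Qed.

Lemma prU A B : measurable A -> measurable B -> A `&` B = set0 ->
  pr (A `|` B) = pr A + pr B.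
Proof.
move=> mA mB AB; apply: EFin_inj; rewrite EFinD -!prE //; last exact: measurableU.
exact: measureU.
Qed.

Lemma prU_le A B : measurable A -> measurable B -> pr (A `|` B) <= pr A + pr B.
Proof.
move=> mA mB.
have -> : A `|` B = A `|` (B `\` A).
  apply/seteqP; split => w /=; last by case=> [|[]]; [left|right].
  by have [|nA] := pselect (A w); [left|case=> // Bw; right].
rewrite prU //; last 2 first.
- exact: measurableD.
- by apply/seteqP; split => // w [Aw []].
by rewrite lerD2l pr_le //; exact: measurableD.
Qed.

Lemma pr_limit_below (F : nat -> set Omega) : (forall n, measurable (F n)) ->
  {homo F : m n / (m <= n)%N >-> m `<=` n} -> forall e : R, 0 < e ->
  exists m, forall n, (m <= n)%N -> pr (\bigcup_k F k) <= pr (F n) + e.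
Proof.
move=> mF ndF e e0.
have mU : measurable (\bigcup_k F k) by exact: bigcupT_measurable.
have : (P \o F) n @[n --> \oo] --> (pr (\bigcup_k F k))%:E.
  rewrite -prE //; apply: nondecreasing_cvg_mu => // m n mn.
  exact/subsetPset/ndF.
move=> /fine_cvgP[_] /cvgrPdist_lt /(_ _ e0)[m _ mP]; exists m => n mn.
have := mP n mn; rewrite /= -/(pr _) -/(pr _) ltr_norml => /andP[_]; lra.
Qed.

Lemma pr_vanish (F : nat -> set Omega) : (forall n, measurable (F n)) ->
  P.-negligible [set w | forall m, exists n, (m <= n)%N /\ F n w] ->
  forall e : R, 0 < e -> exists m, forall n, (m <= n)%N -> pr (F n) <= e.
Proof.
move=> mF neg e e0.
pose C m := \bigcup_(n in [set n | (m <= n)%N]) F n.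
have mC m : measurable (C m) by apply: bigcup_measurable => n _.
have mI : measurable (\bigcap_m C m) by exact: bigcapT_measurable.
have I0 : P (\bigcap_m C m) = 0%E.
  apply: measure_negligible => //; apply: negligibleS neg => w Cw m.
  by have [n mn Fn] := Cw m I; exists n.
have : (P \o C) n @[n --> \oo] --> (0 : R)%:E.
  rewrite -[X in _ --> X]I0; apply: nonincreasing_cvg_mu => //.
    exact: le_lt_trans (probability_le1 P (mC 0%N)) (ltry _).
  move=> m n mn; apply/subsetPset => w [k nk Fk]; exists k => //=.
  exact: leq_trans nk.
move=> /fine_cvgP[_] /cvgrPdist_lt /(_ _ e0)[m _ mP]; exists m => n mn.
have := mP n mn; rewrite /= -/(pr _) sub0r normrN ltr_norml => /andP[_ h].
apply: le_trans (ltW h); apply: pr_le => // w Fw; by exists n => /=.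
Qed.

End RealProbability.

(** * Countability of the vertex set and measurability of path events *)

Section Enumeration.
Variables (R : realType) (N : network R).
Hypotheses (LF : locally_finite N) (CN : connected_net N).

(** The endpoints of paths of length [n] from [o] form a finite list, and by connectedness every
    vertex is on such a list; pairs of a length and an index enumerate them all. *)
Lemma vertex_enum (o : nV N) : exists f : nat -> nV N, forall v, exists n, f n = v.
Proof.
pose ball := fix ball n : seq (nV N) := if n is n'.+1 then
  flatten [seq [seq tgt e | e <- outs y] | y <- ball n'] else [:: o].
pose f m := if @unpickle (nat * nat)%type m is Some (n, i) then nth o (ball n) i else o.
exists f => v; have [k [p [p0 pk pP]]] := CN o v.
suff /(_ k (leqnn k)) : forall n, (n <= k)%N ->
    ((p n : {classic (nV N)}) \in (ball n : seq {classic (nV N)})).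
  rewrite pk => vk; exists (pickle (k, index (v : {classic (nV N)}) (ball k))).
  by rewrite /f pickleK; exact: (@nth_index {classic (nV N)}).
elim=> [|n IH] nk; first by rewrite p0 inE.
have [e [es et]] := pP n nk.
apply/flattenP; exists [seq (tgt e : {classic (nV N)}) | e <- outs (p n)].
  by apply: (@map_f {classic (nV N)} (seq {classic (nV N)})
       (fun y => [seq (tgt e : {classic (nV N)}) | e <- outs (y : nV N)]));
     apply: IH; exact: ltnW.
by apply/mapP; exists e => //; rewrite (mem_outs LF); exact/asboolP.
Qed.

End Enumeration.

Section Measurability.
Context d (Omega : measurableType d) (V : Type) (f : nat -> V).
Hypothesis f_surj : forall v, exists n, f n = v.

Definition shift_cons (v : V) (p : nat -> V) : nat -> V :=
  fun n => if n is n'.+1 then p n' else v.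

(** Split over the countably many values of the first coordinate and shift time by one. *)
Lemma determined_measurable T (X : nat -> Omega -> V) (B : (nat -> V) -> Prop) :
  (forall n v, measurable [set w | X n w = v]) -> determined T B ->
  measurable [set w | B (fun n => X n w)].
Proof.
elim: T X B => [|T IH] X B mX dB.
  have -> : [set w | B (fun n => X n w)] =
      \bigcup_(k in [set k | B (fun=> f k)]) [set w | X 0%N w = f k].
    apply/seteqP; split => [w /= Bw|w [k /= Bk Xk]].
      have [k fk] := f_surj (X 0%N w); exists k => //=; rewrite -(dB (fun n => X n w)) //.
      by move=> i; rewrite leqn0 => /eqP ->.
    by rewrite (dB _ (fun=> f k)) // => i; rewrite leqn0 => /eqP ->.
  by apply: bigcup_measurable => k _.
have -> : [set w | B (fun n => X n w)] =
    \bigcup_k ([set w | X 0%N w = f k] `&`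
               [set w | B (shift_cons (f k) (fun n => X n.+1 w))]).
  apply/seteqP; split => [w /= Bw|w [k _ [/= Xk]]].
    have [k fk] := f_surj (X 0%N w); exists k => //=; split => //.
    by rewrite -(dB (fun n => X n w)) // => -[|i] _.
  by rewrite -(dB (fun n => X n w)) // => -[|i] _.
apply: bigcupT_measurable => k; apply: measurableI => //.
apply: (IH (fun n => X n.+1) (fun q => B (shift_cons (f k) q))) => // p q pq.
by apply: dB => -[|i] //= it; exact: pq.
Qed.

End Measurability.

(** * Law of the random walk *)

Section Walk.
Variables (R : realType) (N : network R).
Local Notation V := (nV N).
Hypotheses (LF : locally_finite N) (CN : connected_net N).
Hypothesis (c_gt0 : forall u, 0 < cvert N u).
Context d (Omega : measurableType d) (P : probability Omega R).
Variable X : nat -> Omega -> V.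
Hypothesis RW : is_random_walk P X.

Let mX n v : measurable [set w | X n w = v].
Proof. by case: RW. Qed.

Lemma path_measurable T (B : (nat -> V) -> Prop) : determined T B ->
  measurable [set w | B (fun n => X n w)].
Proof.
have [wit|nowit] := pselect (exists w : Omega, True).
  have [w _] := wit; have [f fP] := vertex_enum LF CN (X 0%N w).
  exact: (determined_measurable fP mX).
move=> _; rewrite (_ : [set w | _] = set0) //.
by apply/seteqP; split => // w; case: nowit; exists w.
Qed.

Definition cylinder (t : nat) (y : nat -> V) : set Omega :=
  [set w | forall i, (i <= t)%N -> X i w = y i].

Lemma cylinder_measurable t y : measurable (cylinder t y).
Proof.
apply: (@path_measurable t (fun p => forall i, (i <= t)%N -> p i = y i)) => p q pq.
by rewrite propeqE; split=> H i it; [rewrite -pq|rewrite pq]; rewrite ?H.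
Qed.

Lemma pr_cylinderS t y v :
  pr P (cylinder t y `&` [set w | X t.+1 w = v]) = pr P (cylinder t y) * trans N (y t) v.
Proof.
have [_ M] := RW; apply: EFin_inj; rewrite EFinM -!prE ?M //.
  exact: cylinder_measurable.
by apply: measurableI => //; exact: cylinder_measurable.
Qed.

Lemma pr_split t A (s : seq {classic V}) : measurable A -> uniq s ->
  pr P (A `&` [set w | (X t w : {classic V}) \in s]) =
  \sum_(v <- s) pr P (A `&` [set w | X t w = v]).
Proof.
move=> mA; have mS (r : seq {classic V}) :
    measurable [set w | (X t w : {classic V}) \in r].
  apply: (@path_measurable t (fun p => (p t : {classic V}) \in r)) => p q pq.
  by rewrite pq.
elim: s => [|v s IH] /=.
  move=> _; rewrite big_nil (_ : _ `&` _ = set0) ?/pr ?measure0 //.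
  by apply/seteqP; split => // w [].
move=> /andP[vs us]; rewrite big_cons -IH // -prU //; last 3 first.
- exact: measurableI.
- exact: measurableI.
- apply/seteqP; split => // w [[_ /= Xv] [_ /=]]; rewrite Xv => vs'.
  by rewrite vs' in vs.
congr (pr P _); rewrite -setIUr; congr (_ `&` _); apply/seteqP; split => w /=.
  by rewrite inE => /predU1P[]; [left|right].
by rewrite inE => -[->|->]; rewrite ?eqxx ?orbT.
Qed.

Definition nbrs (u : V) : seq {classic V} := undup [seq (tgt e : {classic V}) | e <- outs u].

(** Parallel edges are grouped by their target. *)
Lemma sum_trans u (F : V -> R) : \sum_(v <- nbrs u) trans N u v * F v = step F u.
Proof.
have cpE v : cpair N u v = \sum_(e <- outs u | (tgt e : {classic V}) == v) cond e.
  have sub : (out_edges N u `&` [set e | tgt e = v]) `<=` out_edges N u by move=> e [].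
  rewrite /cpair fsbig_finite; last exact: sub_finite_set sub (LF u).
  rewrite -[RHS]big_filter; apply: perm_big; apply: uniq_perm.
  - exact: finmap.fset_uniq.
  - by rewrite filter_uniq ?outs_uniq.
  move=> e; rewrite in_fset_set; last exact: sub_finite_set sub (LF u).
  rewrite mem_filter (mem_outs LF); apply/idP/andP.
    by rewrite inE => -[/= es et]; split; [exact/eqP|exact/asboolP].
  by move=> [/eqP et /asboolP es]; rewrite inE.
rewrite /step mulr_suml.
transitivity (\sum_(v <- nbrs u) \sum_(e <- outs u | (tgt e : {classic V}) == v)
    cond e * F (tgt e) / cvert N u).
  apply: eq_bigr => v _; rewrite /trans cpE !mulr_suml; apply: eq_bigr => e /eqP <-.
  ring.
rewrite (exchange_big_dep predT) //= big_seq [RHS]big_seq; apply: eq_bigr => e eu.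
rewrite -big_filter.
have -> : [seq v <- nbrs u | (tgt e : {classic V}) == v] = [:: (tgt e : {classic V})].
  rewrite -(@eq_filter _ (pred1 (tgt e : {classic V}))); last by move=> x /=; rewrite eq_sym.
  by rewrite filter_pred1_uniq ?undup_uniq // mem_undup; exact: map_f.
by rewrite big_seq1.
Qed.

(** The Markov property on cylinders, iterated [k] times by splitting over the next vertex. *)
Lemma pr_path k t y (B : (nat -> V) -> Prop) : determined (t + k) B ->
  pr P (cylinder t y `&` [set w | B (fun n => X n w)]) =
  pr P (cylinder t y) * pathE (@step R N) k t (fun q => ind R (B q)) y.
Proof.
elim: k t y => [|k IH] t y dB /=.
  rewrite addn0 in dB.
  have BE w : cylinder t y w -> B (fun n => X n w) = B y.
    by move=> cw; apply: dB => i it; exact: cw.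
  have [By|nBy] := pselect (B y).
    rewrite indT // mulr1; congr (pr P _); apply/seteqP; split => w; first by case.
    by move=> cw; split => //=; rewrite BE.
  rewrite indF // mulr0 (_ : _ `&` _ = set0) ?/pr ?measure0 //.
  by apply/seteqP; split => // w [cw] /=; rewrite BE.
set A := cylinder t y `&` _.
have mc := cylinder_measurable t y.
have mB : measurable [set w | B (fun n => X n w)] by exact: path_measurable dB.
have mA : measurable A by exact: measurableI.
pose D := [set w | (X t.+1 w : {classic V}) \in nbrs (y t)].
have mD : measurable D.
  apply: (@path_measurable t.+1 (fun p => (p t.+1 : {classic V}) \in nbrs (y t))).
  by move=> p q pq; rewrite pq.
have cylS v : cylinder t.+1 (stop y t.+1 v) = cylinder t y `&` [set w | X t.+1 w = v].
  apply/seteqP; split => w /=.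
    move=> H; split=> [i it|]; first by rewrite H ?leqW // agree_stop.
    by rewrite H // stop_last.
  move=> [H1 H2] i; rewrite leq_eqVlt => /predU1P[->|it]; first by rewrite stop_last.
  by rewrite agree_stop // H1.
(* The transition probabilities to neighbours sum to [1], so on the cylinder the next vertex is
   almost surely in the finite list [nbrs (y t)]. *)
have cD : pr P (cylinder t y `&` D) = pr P (cylinder t y).
  rewrite pr_split ?undup_uniq //.
  under eq_bigr do rewrite pr_cylinderS.
  rewrite -mulr_sumr -[RHS]mulr1 -(step1 LF c_gt0 (y t)) -sum_trans.
  by congr (_ * _); apply: eq_bigr => v _; rewrite mulr1.
have cDC : pr P (cylinder t y `\` D) = 0.
  have := @prU _ _ _ P (cylinder t y `&` D) (cylinder t y `\` D).
  rewrite setUIDK cD => /(_ (measurableI _ _ mc mD) (measurableD mc mD)).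
  move=> H; have : pr P (cylinder t y) = pr P (cylinder t y) + pr P (cylinder t y `\` D).
    by apply: H; rewrite setDE setIACA setICr setI0.
  by lra.
have AD : pr P A = pr P (A `&` D).
  have mAD := measurableI _ _ mA mD; have mADC := measurableD mA mD.
  rewrite -{1}(setUIDK A D) prU //; last by rewrite setDE setIACA setICr setI0.
  suff -> : pr P (A `\` D) = 0 by rewrite addr0.
  apply: le_anti; rewrite pr_ge0 andbT -cDC pr_le //; first exact: measurableD.
  by move=> w [[cw _] Dw].
rewrite AD pr_split ?undup_uniq // -sum_trans mulr_sumr; apply: eq_bigr => v _.
rewrite mulrA -pr_cylinderS -cylS -IH ?addSnnS // cylS; congr (pr P _).
by rewrite /A setIAC.
Qed.

End Walk.

(** * From the uniform bound to infinitely many cut times *)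

Section ZeroOne.
Variables (R : realType) (N : network R).
Local Notation V := (nV N).
Hypotheses (LF : locally_finite N) (CN : connected_net N).
Hypothesis (c_gt0 : forall u, 0 < cvert N u).
Context d (Omega : measurableType d) (P : probability Omega R).
Variable X : nat -> Omega -> V.
Hypothesis RW : is_random_walk P X.
Variables (x0 : V) (kap h : V -> R).
Hypotheses (kap_ge0 : forall x, 0 <= kap x) (kap_le1 : forall x, kap x <= 1).
Hypotheses (h_ge0 : forall x, 0 <= h x).
Hypothesis (Qh : forall x, killed (@step R N) kap h x <= h x).

(** The start is fixed by intersection rather than by conditioning, so starting at [x0] may have
    probability zero. *)
Definition walk_event (B : (nat -> V) -> Prop) : set Omega :=
  [set w | X 0%N w = x0 /\ B (fun n => X n w)].
Local Notation ev := walk_event.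

Lemma walk_event_measurable T (B : (nat -> V) -> Prop) :
  determined T B -> measurable (ev B).
Proof.
move=> dB; apply: (@path_measurable _ _ LF CN _ _ _ _ RW T (fun p => p 0%N = x0 /\ B p)).
by move=> p q pq; rewrite (dB _ _ pq) pq.
Qed.

Lemma pr_walk_event T (B : (nat -> V) -> Prop) : determined T B ->
  pr P (ev B) = pr P [set w | X 0%N w = x0] *
    pathE (@step R N) T 0 (fun q => ind R (B q)) (fun=> x0).
Proof.
move=> dB.
have c0 : cylinder X 0 (fun=> x0) = [set w | X 0%N w = x0].
  apply/seteqP; split => w /= => [H|w0 i]; first exact: H.
  by rewrite leqn0 => /eqP ->.
have := @pr_path _ _ LF CN c_gt0 _ _ _ _ RW T 0 (fun=> x0) B dB.
by rewrite c0.
Qed.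

Lemma has_cut_determined t n T : (n <= T)%N -> determined T (has_cut h t n T).
Proof.
suff H p q : (n <= T)%N -> agree T p q -> has_cut h t n T p -> has_cut h t n T q.
  by move=> nT p q pq; rewrite propeqE; split; apply: H => //; exact: agree_sym.
move=> nT pq [i [/andP[ti i_n] iP]]; exists i; rewrite ti i_n; split => // m l im li.
by rewrite -!pq; [exact: iP| lia |lia].
Qed.

Lemma killing_above_determined t T e : determined T (@killing_above R V kap t T e).
Proof.
move=> p q pq; rewrite /killing_above; congr (is_true (_ < _)).
by rewrite big_nat [RHS]big_nat; apply: eq_bigr => i /andP[_ iT]; rewrite pq // ltnW.
Qed.

Lemma descent_determined t n T : (t + n ^ 6 <= T)%N -> determined T (descent h t n).
Proof.
suff H p q : (t + n ^ 6 <= T)%N -> agree T p q -> descent h t n p -> descent h t n q.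
  by move=> nT p q pq; rewrite propeqE; split; apply: H => //; exact: agree_sym.
move=> tT pq [H1 H2]; split=> [i it|]; last by rewrite -pq.
by rewrite -pq ?H1 //; lia.
Qed.

Lemma and_determined T (B C : (nat -> V) -> Prop) :
  determined T B -> determined T C -> determined T (fun p => B p /\ C p).
Proof. by move=> dB dC p q pq; rewrite (dB _ _ pq) (dC _ _ pq). Qed.

Lemma not_determined T (B : (nat -> V) -> Prop) :
  determined T B -> determined T (fun p => ~ B p).
Proof. by move=> dB p q pq; rewrite (dB _ _ pq). Qed.

Lemma determined_le S T (B : (nat -> V) -> Prop) : (S <= T)%N ->
  determined S B -> determined T B.
Proof. by move=> ST dB p q pq; apply: dB => i iS; apply: pq; exact: leq_trans ST. Qed.

Lemma walk_cut_bound n j t T (e : R) (A : (nat -> V) -> Prop) :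
  determined t A -> 1 <= ln (n%:R : R) -> 0 <= e -> T = (t + n ^ 6 + j)%N ->
  pr P (ev (fun q => A q /\ descent h t n q)) / 11 <=
  pr P (ev (fun q => A q /\ has_cut h t (t + n ^ 6) T q))
  + 2 * (e + pr P (ev (killing_above kap t T e))) + (1 + 10 * ln (n%:R : R))^-1.
Proof.
move=> dA ln1n e0 TE.
have dAT : determined T A by apply: determined_le dA; lia.
rewrite !(@pr_walk_event T); last first.
- by apply: and_determined => //; apply: descent_determined; lia.
- by apply: and_determined => //; apply: has_cut_determined; lia.
- exact: killing_above_determined.
have m0 : measurable [set w | X 0%N w = x0] by case: RW.
have p0 := pr_ge0 P [set w | X 0%N w = x0].
have p1 := pr_le1 P m0.
have := cut_bound0 (step_submarkov LF c_gt0) (step1 LF c_gt0) kap_ge0 kap_le1 h_ge0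
  Qh (fun=> x0) dA ln1n e0 TE.
set p := pr _ _ in p0 p1 *; move=> /(ler_wpM2l p0).
have l0 : 0 <= (1 + 10 * ln (n%:R : R))^-1 by rewrite invr_ge0; lra.
have h1 : p * e <= e by rewrite -[leRHS]mul1r ler_wpM2r.
have h2 : p * (1 + 10 * ln (n%:R : R))^-1 <= (1 + 10 * ln (n%:R : R))^-1.
  by rewrite -[leRHS]mul1r ler_wpM2r.
move: h2; set L := _^-1; lra.
Qed.

Definition tame (p : nat -> V) : Prop :=
  (forall e : R, 0 < e -> exists t0, forall t T, (t0 <= t)%N -> ~ killing_above kap t T e p) /\
  (forall t, exists n0, forall n, (n0 <= n)%N -> descent h t n p).

Hypothesis tame_ae : P.-negligible (ev (fun p => ~ tame p)).

Lemma killing_vanish (e : R) : 0 < e -> exists t0, forall t T, (t0 <= t)%N ->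
  pr P (ev (killing_above kap t T e)) <= e.
Proof.
move=> e0.
pose F t := ev (fun p => exists T, killing_above kap t T e p).
have mK t T : measurable (ev (killing_above kap t T e)).
  exact: walk_event_measurable (@killing_above_determined _ _ _).
have FE t : F t = \bigcup_T ev (killing_above kap t T e).
  apply/seteqP; split => w [w0]; first by move=> [T KT]; exists T.
  by move=> _ [? KT]; split => //; exists w0.
have mF t : measurable (F t) by rewrite FE; exact: bigcupT_measurable.
have [t0 t0P] : exists m, forall n, (m <= n)%N -> pr P (F n) <= e.
  apply: pr_vanish => //; apply: negligibleS tame_ae => w H.
  split; first by have [n [_ []]] := H 0%N.
  move=> [/(_ e e0)[t0 t0P] _]; have [t [tt [_ [T KT]]]] := H t0.
  exact: t0P tt KT.
exists t0 => t T tt; apply: le_trans (t0P _ tt); apply: pr_le => //.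
by move=> w [w0 KT]; split => //; exists T.
Qed.

Lemma descent_vanish t (e : R) : 0 < e -> exists n0, forall n, (n0 <= n)%N ->
  pr P (ev (fun p => ~ descent h t n p)) <= e.
Proof.
move=> e0; apply: pr_vanish => // [n|].
  by apply: walk_event_measurable; apply: not_determined; apply: descent_determined; exact: leqnn.
apply: negligibleS tame_ae => w H.
split; first by have [n [_ []]] := H 0%N.
by move=> [_ /(_ t)[n0 n0P]]; have [n [nn [_]]] := H n0; apply; exact: n0P.
Qed.

Section NoCut.
Variable m : nat.

(** A level cut may be destroyed later, so [bad n T] grows with [T]; its limit [badoo n] says that
    no permanent level cut lies in [(m, n]], and shrinks as [n] grows. *)
Let bad (n T : nat) := ev (fun p => ~ has_cut h m n T p).
Let badoo (n : nat) := \bigcup_T bad n (n + T).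

Let has_cut_le n n' T T' p : (n <= n')%N -> (T <= T')%N ->
  has_cut h m n T' p -> has_cut h m n' T p.
Proof.
move=> nn TT [i [/andP[mi i_n] iP]]; exists i; split; first by rewrite mi (leq_trans i_n).
by move=> k l /andP[ik kT] li; apply: iP => //; rewrite ik (leq_trans kT).
Qed.

Let mbad n T : (n <= T)%N -> measurable (bad n T).
Proof.
by move=> nT; apply: walk_event_measurable; apply: not_determined; exact: has_cut_determined.
Qed.

Let mbadoo n : measurable (badoo n).
Proof. by apply: bigcupT_measurable => T; apply: mbad; exact: leq_addr. Qed.

Let bad_sub n T : (n <= T)%N -> bad n T `<=` badoo n.
Proof. by move=> nT w bw; exists (T - n)%N => //; rewrite subnKC. Qed.

Let badoo_decr n n' : (n <= n')%N -> badoo n' `<=` badoo n.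
Proof.
move=> nn w [T _ [w0 nc]]; exists (n' - n + T)%N => //; split => // hc; apply: nc.
by apply: has_cut_le hc => //; lia.
Qed.

Let badoo_approx n (e : R) : 0 < e -> exists T0, forall T, (T0 <= T)%N ->
  pr P (badoo n) <= pr P (bad n (n + T)) + e.
Proof.
move=> e0; apply: pr_limit_below => // [T|T T' TT w [w0 nc]].
  by apply: mbad; exact: leq_addr.
by split => // hc; apply: nc; apply: has_cut_le hc => //; rewrite leq_add2l.
Qed.

(** Take [n] nearly attaining the infimum [l]. On [bad n t] a new cut in [(t, n']] occurs with
    probability about [l / 11] at least. Such paths lie in [badoo n] but not in [bad n' T], and
    these two probabilities differ by at most [2 * e], which forces [l] to be small. *)
Let badoo_inf : inf (range (fun n => pr P (badoo n))) = 0.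
Proof.
set l := inf _.
have lP n : l <= pr P (badoo n).
  by apply: ge_inf; [exists 0 => _ [k _ <-]; exact: pr_ge0 | exists n].
have l0 : 0 <= l.
  by apply: lb_le_inf; [exists (pr P (badoo 0)), 0%N | move=> _ [k _ <-]; exact: pr_ge0].
apply: le_anti; rewrite l0 andbT; apply/ler_addgt0Pr => e' e'0; rewrite add0r.
(* The errors give [l <= 79 * e]: [2 * e] from near attainment and [5 * e] from the cut bound, both
   multiplied by [11], and [2 * e] in passing from [badoo n] to [D]. *)
pose e := e' / 100; have e0 : 0 < e by rewrite divr_gt0.
have [_ [n _ <-] nP] : exists2 x, range (fun n => pr P (badoo n)) x & x < l + e.
  by apply: inf_adherent => //; split;
    [exists (pr P (badoo 0)), 0%N | exists 0 => _ [k _ <-]; exact: pr_ge0].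
have [T1 T1P] := badoo_approx n e0.
have [t0 t0P] := killing_vanish e0.
(* Order of choice: [t] makes late killing unlikely and [bad n t] close to [badoo n]; then [k] makes
   the descent from [t] likely; [j] comes last. *)
pose t := (n + T1 + t0 + m)%N.
have nt : (n <= t)%N by rewrite /t; clear; lia.
have mt : (m <= t)%N by rewrite /t; clear; lia.
have t0t : (t0 <= t)%N by rewrite /t; clear; lia.
have T1t : (T1 <= t - n)%N by rewrite /t; clear; lia.
have tE : t = (n + (t - n))%N by rewrite subnKC.
have ht : pr P (badoo n) <= pr P (bad n t) + e by rewrite tE; exact: T1P.
have [n1 n1P] := descent_vanish t e0.
have [n2 n2P] := ln_eventually (1 + e^-1).
pose k := (n1 + n2)%N.
have lk : 1 + e^-1 <= ln (k%:R : R) by apply: n2P; exact: leq_addl.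
have eV0 : 0 < e^-1 by rewrite invr_gt0.
have lk1 : 1 <= ln (k%:R : R) by lra.
have dk : pr P (ev (fun p => ~ descent h t k p)) <= e by apply: n1P; exact: leq_addr.
pose n' := (t + k ^ 6)%N.
have [j jP] := badoo_approx n' e0; have {}jP := jP j (leqnn j).
pose T := (n' + j)%N.
have tn' : (t <= n')%N by exact: leq_addr.
have n'T : (n' <= T)%N by exact: leq_addr.
have tT := leq_trans tn' n'T; have nn' := leq_trans nt tn'.
have dA : determined t (fun p => ~ has_cut h m n t p).
  by apply: not_determined; exact: has_cut_determined.
have := walk_cut_bound (j := j) dA lk1 (ltW e0) (erefl T).
have := t0P t T t0t.
have le : (1 + 10 * ln (k%:R : R))^-1 <= e.
  rewrite -[leRHS]invrK lef_pV2 ?posrE //; lra.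
set G := ev (fun q => _ /\ has_cut _ _ _ _ _).
set D := ev (fun q => _ /\ descent _ _ _ _).
have mG : measurable G.
  apply: (@walk_event_measurable T); apply: and_determined.
    exact: determined_le dA.
  exact: has_cut_determined.
have mND : measurable (ev (fun p => ~ descent h t k p)).
  by apply: (@walk_event_measurable n'); apply: not_determined; exact: descent_determined.
have mD : measurable D.
  apply: (@walk_event_measurable n'); apply: and_determined; last exact: descent_determined.
  exact: determined_le dA.
have hD : pr P (bad n t) <= pr P D + pr P (ev (fun p => ~ descent h t k p)).
  apply: le_trans (prU_le _ mD mND); apply: pr_le; first exact: mbad.
    exact: measurableU.
  move=> w [w0 nc]; have [dw|ndw] := pselect (descent h t k (fun n => X n w)).
    by left.
  by right.
have mB' : measurable (bad n' T) by exact: mbad.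
have hG : pr P G + pr P (bad n' T) <= pr P (badoo n).
  rewrite -prU //.
    apply: pr_le => //; first exact: measurableU.
    move=> w [[w0 [nc _]]|bw]; first exact: (bad_sub nt).
    exact: (badoo_decr nn' (bad_sub n'T bw)).
  apply/seteqP; split => // w [[w0 [_ [i [/andP[ti i_n] iP]]]] [_ nc]].
  by apply: nc; exists i; split => //; rewrite i_n (leq_ltn_trans mt ti).
have := lP n'; have := lP n.
move: le jP nP ht dk hD hG; rewrite -/T -/n'.
set L := _^-1; set K := pr P (ev (killing_above _ _ _ _)).
rewrite /e; lra.
Qed.

(** The event lies in every [badoo n]: the finitely many horizons at which the candidates up to [n]
    fail are replaced by their maximum. *)
Lemma no_cut_negligible :
  P.-negligible (ev (fun p => forall i, (m < i)%N -> exists T, ~ level_cut h T i p)).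
Proof.
have mI : measurable (\bigcap_n badoo n) by exact: bigcapT_measurable.
exists (\bigcap_n badoo n); split => //.
  rewrite prE //; congr EFin; apply: le_anti; rewrite pr_ge0 andbT.
  rewrite -badoo_inf; apply: lb_le_inf; first by exists (pr P (badoo 0)), 0%N.
  by move=> _ [n _ <-]; apply: pr_le => // w; exact.
move=> w [w0 H] n _.
have [T TP] : exists T, forall i, (m < i <= n)%N -> ~ level_cut h T i (fun n => X n w).
  elim: n => [|n [T TP]]; first by exists 0%N => i; lia.
  have [mn|nm] := ltnP m n.+1; last by exists T => i; lia.
  have [T' T'P] := H _ mn.
  have mono S S' i : (S <= S')%N -> ~ level_cut h S i (fun n => X n w) ->
      ~ level_cut h S' i (fun n => X n w).
    by move=> SS nl lc; apply: nl => k l /andP[ik kS] li; apply: lc => //; rewrite ik (leq_trans kS).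
  exists (maxn T T') => i /andP[mi]; rewrite leq_eqVlt => /predU1P[->|it].
    exact: mono (leq_maxr _ _) T'P.
  by apply: mono (leq_maxl _ _) (TP _ _); rewrite mi.
exists T => //; split => // -[i [mi lc]]; apply: (TP i mi).
by move=> k l /andP[ik kT] li; apply: lc => //; rewrite ik (leq_trans kT) ?leq_addl.
Qed.

End NoCut.

Lemma finite_cuts_negligible :
  P.-negligible [set w | X 0%N w = x0 /\
    ~ infinite_set [set n : nat | cut_time (fun i => X i w) n]].
Proof.
apply: (@negligibleS _ _ _ P (\bigcup_m
  ev (fun p => forall i, (m < i)%N -> exists T, ~ level_cut h T i p))); last first.
  by apply: negligible_bigcup => m; exact: no_cut_negligible.
move=> w [w0 fin].
have {}fin : finite_set [set n : nat | cut_time (fun i => X i w) n] by exact: contrapT.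
have [m mP] : exists m, forall n, cut_time (fun i => X i w) n -> (n <= m)%N.
  have [s sE] := (finite_seqP _).1 fin.
  exists (\max_(i <- s) i)%N => n cn; have ns : n \in s.
    by have : [set` s] n by rewrite -sE.
  by rewrite (big_rem _ ns) /= leq_maxl.
(* A permanent level cut at [i] gives the cut time [i.-1], which exceeds [m] because [i > m.+1]. *)
exists m.+1 => //; split => // i mi; apply: contrapT => nT.
have lc T : level_cut h T i (fun n => X n w).
  by apply: contrapT => nl; apply: nT; exists T.
suff /mP : cut_time (fun i => X i w) i.-1 by lia.
apply/seteqP; split => // v [[l /= li lv] [k /= ik kv]].
have := lc k k l; rewrite leqnn andbT lv kv ltxx => /(_ _ _)H.
by have := H ltac:(lia) ltac:(lia).
Qed.

End ZeroOne.

(** * Pathwise consequences of the speed hypothesis *)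

Section Superdiffusive.
Variable R : realType.

Lemma limn_einf_gt0 (u : nat -> R) : (0 < limn_einf (fun n => (u n)%:E))%E ->
  exists2 eps : R, 0 < eps & exists n0, forall n, (n0 <= n)%N -> eps <= u n.
Proof.
rewrite limn_einf_lim (cvg_lim _ (@cvg_einfs_sup _ _)) //.
move=> /ereal_sup_gt[_ [m _ <-] mP].
have uP n : (m <= n)%N -> (einfs (fun n => (u n)%:E) m <= (u n)%:E)%E.
  by move=> mn; apply: ereal_inf_lbound; exists n.
move: mP uP; case: (einfs _ m) => [eps| |] //.
  by rewrite lte_fin => eps0 uP; exists eps => //; exists m => n /uP; rewrite lee_fin.
by move=> _ /(_ m (leqnn m)).
Qed.

Variable N : network R.
Variables (o : nV N) (h : nV N -> R) (p : nat -> nV N).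
Hypotheses (h_gt0 : forall x, 0 < h x) (h_le : forall x, h x <= (dist1 o x)^-1).
Variables (eps r : R) (n0 : nat).
Hypotheses (eps_gt0 : 0 < eps) (r_ge1 : 1 <= r).
Hypothesis speed : forall n, (n0 <= n)%N ->
  eps <= (gdist N o (p n))%:R / (Num.sqrt (n%:R : R) * powR (ln (n%:R : R)) r).

Let speed1 n : (n0 <= n)%N -> 1 <= ln (n%:R : R) ->
  eps * (Num.sqrt (n%:R : R) * ln (n%:R : R)) <= dist1 o (p n).
Proof.
move=> nn ln1.
have n_gt0 : 0 < n%:R :> R.
  by rewrite ltr0n lt0n; apply: contraTneq ln1 => ->; rewrite ln0 // -ltNge ltr01.
have l0 : 0 < ln (n%:R : R) by exact: lt_le_trans ln1.
have s0 : 0 < Num.sqrt (n%:R : R) by rewrite sqrtr_gt0.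
have lr : ln (n%:R : R) <= powR (ln (n%:R : R)) r.
  by rewrite -[leLHS]powRr1 ?(ltW l0) // ler_powR.
have := speed nn; rewrite ler_pdivlMr; last by rewrite mulr_gt0 // powR_gt0.
move=> H; have dd : (gdist N o (p n))%:R <= dist1 o (p n) :> R by rewrite ler_nat.
apply: le_trans dd; apply: le_trans H.
by rewrite ler_pM2l // ler_pM2l.
Qed.

Let c := 9 / eps ^+ 2.

Let c_gt0 : 0 < c.
Proof. by rewrite divr_gt0 // exprn_gt0. Qed.

(** The rate is at most of order [1 / (n * ln n ^ 2)]; since [1 / n.+1 <= ln n.+1 - ln n], it is
    dominated by an increment of [- 1 / ln n], and the sum telescopes. *)
Let kill_step_le n : (n0 <= n.+1)%N -> 1 <= ln (n%:R : R) ->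
  kill_rate o (p n.+1) <= c * ((ln (n%:R : R))^-1 - (ln (n.+1%:R : R))^-1).
Proof.
move=> nn ln1.
have n_gt0 : 0 < n%:R :> R.
  by rewrite ltr0n lt0n; apply: contraTneq ln1 => ->; rewrite ln0 // -ltNge ltr01.
have nS : n.+1%:R = n%:R + 1 :> R by rewrite natr1.
have nS0 : 0 < n.+1%:R :> R by rewrite ltr0n.
have lS : ln (n%:R : R) <= ln (n.+1%:R : R) by rewrite ler_ln ?posrE // ler_nat.
have ln2 : 1 <= ln (n.+1%:R : R) by exact: le_trans lS.
have diff : n.+1%:R^-1 <= ln (n.+1%:R : R) - ln (n%:R : R).
  rewrite -ln_div ?posrE //; apply: le_trans (ln_ge_1subV _); last by rewrite divr_gt0.
  have -> : 1 - (n.+1%:R / n%:R)^-1 = n.+1%:R^-1 :> R; last exact: lexx.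
  by rewrite nS; field; rewrite -nS !gt_eqF.
have sp := speed1 nn ln2.
set l := ln (n.+1%:R : R) in lS ln2 diff sp *; set l' := ln (n%:R : R) in ln1 lS diff *.
have l0 : 0 < l by lra.
have l'0 : 0 < l' by lra.
have sq : eps ^+ 2 * (n.+1%:R * l ^+ 2) <= dist1 o (p n.+1) ^+ 2.
  have -> : eps ^+ 2 * (n.+1%:R * l ^+ 2) = (eps * (Num.sqrt n.+1%:R * l)) ^+ 2.
    by rewrite !exprMn sqr_sqrtr // ler0n.
  rewrite ler_pXn2r // nnegrE; last exact: le_trans (dist1_ge1 _ _).
  by rewrite !mulr_ge0 ?sqrtr_ge0 // ltW.
have q0 : 0 < eps ^+ 2 * (n.+1%:R * l ^+ 2) by rewrite !mulr_gt0 ?exprn_gt0.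
have : kill_rate o (p n.+1) <= 9 / (eps ^+ 2 * (n.+1%:R * l ^+ 2)).
  rewrite /kill_rate ler_pM2l // lef_pV2 ?posrE //; first by lra.
  by rewrite ltr_wpDl // sqr_ge0.
move=> /le_trans; apply.
rewrite invfM mulrA -/c ler_pM2l //.
have -> : l'^-1 - l^-1 = (l - l') / (l' * l) by field; rewrite !gt_eqF.
rewrite invfM; apply: ler_pM; rewrite ?invr_ge0 ?ler0n ?sqr_ge0 //.
by rewrite lef_pV2 ?posrE ?mulr_gt0 ?exprn_gt0 // expr2 ler_pM2r.
Qed.

Lemma superdiffusive_tame : tame (kill_rate o) h p.
Proof.
have [n1 n1P] := ln_eventually (1 : R).
split=> [e e0|t].
  have [n2 n2P] := ln_eventually (c / e).
  (* The successor allows for the index shift in [kill_step_le], which bounds the rate at time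
     [k.+1] through [ln k]. *)
  exists (n0 + n1 + n2).+1 => -[//|t] T tt; apply/negP; rewrite -leNgt.
  have l1 k : (t <= k)%N -> 1 <= ln (k%:R : R) by move=> tk; apply: n1P; lia.
  have [Tt|tT] := leqP T t.+1; first by rewrite big_geq // ltW.
  have bnd k : \sum_(t.+1 <= i < t.+1 + k) kill_rate o (p i) <=
      c * ((ln (t%:R : R))^-1 - (ln ((t + k)%:R : R))^-1).
    elim: k => [|k IH]; first by rewrite !addn0 big_geq // subrr mulr0.
    rewrite addnS big_nat_recr ?leq_addr //= addSn addnS.
    have := @kill_step_le (t + k) ltac:(lia) (l1 _ (leq_addr _ _)).
    by move: IH; rewrite addSn; lra.
  have := bnd (T - t.+1)%N; rewrite subnKC; last exact: ltnW.
  move=> /le_trans; apply.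
  have lt0 : 0 < ln (t%:R : R) by apply: lt_le_trans (l1 t (leqnn t)).
  have lT : 0 <= (ln ((t + (T - t.+1))%:R : R))^-1.
    by rewrite invr_ge0 (le_trans ler01) // l1 // leq_addr.
  have : c / ln (t%:R : R) <= e.
    rewrite ler_pdivrMr // mulrC -ler_pdivrMr //; apply: n2P; lia.
  by move: c_gt0 lT => c0 lT; nra.
(* [m0] exceeds [1 / h] at each of the finitely many times up to [t]; [m1] makes [eps * n >= 1]. *)
pose m0 := (\sum_(i < t.+1) (Num.truncn (h (p i))^-1).+1)%N.
pose m1 := (Num.truncn eps^-1).+1.
exists (m0 + n0 + n1 + m1)%N => n nn.
have m0n : (m0 <= n)%N by apply: leq_trans nn; rewrite -!addnA leq_addr.
have n0n : (n0 <= n)%N by apply: leq_trans nn; rewrite -addnA (leq_trans (leq_addl m0 n0)) ?leq_addr.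
have n1n : (n1 <= n)%N.
  by apply: leq_trans nn; exact: leq_trans (leq_addl (m0 + n0) n1) (leq_addr m1 _).
have m1n : (m1 <= n)%N by apply: leq_trans nn; rewrite leq_addl.
have n_gt0 : (0 < n)%N by exact: leq_trans m1n.
have ng : 0 < n%:R :> R by rewrite ltr0n.
split=> [i it|].
  rewrite -[leRHS]invrK lef_pV2 ?posrE ?invr_gt0 //.
  apply: le_trans (ltW (truncnS_gt _)) _; rewrite ler_nat.
  apply: leq_trans m0n; have ti : (i < t.+1)%N by [].
  by rewrite /m0 (bigD1 (Ordinal ti)) //= leq_addr.
have n6 : (n <= t + n ^ 6)%N.
  apply: leq_trans (leq_addl _ _); by rewrite -{1}(expn1 n) leq_pexp2l.
have ln6 : 1 <= ln ((t + n ^ 6)%:R : R) by apply: n1P; exact: leq_trans n6.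
have := speed1 (leq_trans n0n n6) ln6.
set l := ln _ in ln6 *; set D := dist1 _ _ => sp.
(* The exponent [6] makes the distance at least [eps * n ^ 3], hence at least [n ^ 2] once
   [eps * n >= 1]. *)
have n3 : n%:R ^+ 3 <= Num.sqrt ((t + n ^ 6)%:R : R).
  rewrite -[leLHS]ger0_norm ?exprn_ge0 // -sqrtr_sqr ler_sqrt ?ler0n //.
  by rewrite -exprM -natrX ler_nat leq_addl.
have en : 1 <= eps * n%:R.
  rewrite -ler_pdivrMl // mulr1; apply: le_trans (ltW (truncnS_gt _)) _.
  by rewrite ler_nat.
have D0 : 0 < D := lt_le_trans ltr01 (dist1_ge1 _ _).
apply: le_trans (h_le _) _; rewrite -/D lef_pV2 ?posrE ?exprn_gt0 //.
apply: le_trans sp.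
have s0 := sqrtr_ge0 ((t + n ^ 6)%:R : R); set s := Num.sqrt _ in n3 s0 *.
have h1 : s <= s * l by rewrite ler_peMr.
have h2 : eps * n%:R ^+ 3 <= eps * (s * l) by rewrite ler_pM2l //; exact: le_trans h1.
apply: le_trans h2; rewrite exprS mulrA ler_peMl // exprn_ge0 //.
Qed.

End Superdiffusive.

(** * Union over the starting vertices *)

Unset Implicit Arguments.

Theorem theorem1p4 (R : realType) (N : network R)
  (d : measure_display) (Omega : measurableType d) (P : probability Omega R)
  (X : nat -> Omega -> nV N) :
  locally_finite N -> connected_net N ->
  0 < inf (range (cvert N)) ->
  is_random_walk P X ->
  (exists r : R, 3%:R / 2%:R < r /\
     {ae P, forall w, (0 < limn_einf (fun n : nat =>
        ((gdist N (X 0%N w) (X n w))%:R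
         / (Num.sqrt (n%:R : R) * powR (ln (n%:R : R)) r))%:E))%E}) ->
  {ae P, forall w, infinite_set [set n : nat | cut_time (fun i => X i w) n]}.
Proof.
move=> LF CN c0_gt0 RW [r [r32 speed_ae]].
have c0_le u : inf (range (cvert N)) <= cvert N u.
  by apply: ge_inf; [exists 0 => _ [v _ <-]; exact: cvert_ge0 | exists u].
have c_gt0 u : 0 < cvert N u := lt_le_trans c0_gt0 (c0_le u).
have start x0 : P.-negligible [set w | X 0%N w = x0 /\
    ~ infinite_set [set n : nat | cut_time (fun i => X i w) n]].
  have [h [h_gt0 h_le Qh]] := superharmonic_exists LF CN c0_gt0 c0_le x0.
  apply: (finite_cuts_negligible LF CN c_gt0 RW (kill_rate_ge0 x0) (kill_rate_le1 x0)
    (fun x => ltW (h_gt0 x)) Qh).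
  apply: negligibleS speed_ae => w [w0 nt] sp; apply: nt.
  have [eps eps0 [n0 n0P]] := limn_einf_gt0 sp.
  apply: (superdiffusive_tame h_gt0 h_le eps0 (r := r) (n0 := n0)); first by lra.
  by move=> n /n0P; rewrite w0.
have [[w _]|nowit] := pselect (exists w : Omega, True); last first.
  apply: (@negligibleS _ _ _ P set0); last exact: negligible_set0.
  by move=> w _; case: nowit; exists w.
(* The superharmonic function depends on the start; countability of the vertices lets the null sets
   for the different starts be united. *)
have [f fP] := vertex_enum LF CN (X 0%N w).
apply: (@negligibleS _ _ _ P (\bigcup_k [set w | X 0%N w = f k /\
    ~ infinite_set [set n : nat | cut_time (fun i => X i w) n]])); last first.
  by apply: negligible_bigcup => k; exact: start.
move=> w' nw'; have [k fk] := fP (X 0%N w'); exists k => //; split => //.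
Qed.
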